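(* Let $N\in\mathbb{N}$ and for $k\in\{1,\dots,N\}$ let $I_k\subseteq\mathbb{R}$ be an interval with non-empty interior and non-empty complement. Let $P_{1}=P_{1}^{*}\in\mathbb{R}^{N\times N}$ be invertible and compatible. Then there exist $n,m_{+},m_{-}\in\mathbb{N}_{0}$ with $n+m_{+}+m_{-}=N$ and a (bounded linear) invertible operator $\mathcal{V}\colon\bigoplus_{k=1}^{N}L^{2}(I_{k})\to L^{2}(n,m_{+},m_{-})$ such that $$\mathcal{V}P_{1}\partial_{x}\mathcal{V}^{*}=\partial_{x},$$ where $\partial_x$ on the left-hand side is the derivative on $\bigoplus_{k=1}^{N}L^{2}(I_{k})$ with domain $\bigoplus_{k=1}^N H^1(I_k)$ and $\partial_x$ on the right-hand side is the derivative on $L^2(n,m_+,m_-)$ with domain $H^1(n,m_+,m_-)$. More precisely, $\mathcal{V}$ can be given as a product of constant matrices, the unitary operator $\Psi$ (described in the context), and a diagonal operator with identities and reflections $u\mapsto u(-\,\cdot)$ on the diagonal.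
   Context: All function spaces consist of real-valued functions. $\partial_x$ on $\bigoplus_{k=1}^N L^2(I_k)$ is the operator $(\phi_k)_k\mapsto(\phi_k')_k$ with domain $\bigoplus_{k=1}^N H^1(I_k)$. A matrix $P_1\in\mathbb{R}^{N\times N}$ acts by $(P_1u)_j=\sum_k (P_1)_{jk}u_k$, where functions on $I_k$ are extended by zero to $\mathbb{R}$; $P_1$ is called compatible if it leaves the space $\bigoplus_{k=1}^N L^2(I_k)$ invariant. For $n,m_+,m_-\in\mathbb{N}_0$, $$L^{2}(n,m_{+},m_{-}):=L^{2}(]-\tfrac12,\tfrac12[)^{n}\oplus L^{2}(]-\tfrac12,\infty[)^{m_{+}}\oplus L^{2}(]-\infty,\tfrac12[)^{m_{-}},$$ $$H^{1}(n,m_{+},m_{-}):=H^{1}(]-\tfrac12,\tfrac12[)^{n}\oplus H^{1}(]-\tfrac12,\infty[)^{m_{+}}\oplus H^{1}(]-\infty,\tfrac12[)^{m_{-}},$$ and $\partial_x$ on $L^2(n,m_+,m_-)$ is the componentwise derivative with domain $H^1(n,m_+,m_-)$. The operator $\Psi$: let $n$ be the number of bounded $I_k$, $\tilde m_+$ the number of $I_k$ with $\sup I_k=\infty$, and $\tilde m_-$ the number of $I_k$ with $\inf I_k=-\infty$. Then $\Psi:\bigoplus_{k=1}^N L^2(I_k)\to L^2(n,\tilde m_+,\tilde m_-)$ is the unitary operator which (with the coordinates ordered such that the bounded intervals come first, then those with $\sup I_k=\infty$, then those with $\inf I_k=-\infty$) acts in the $k$-th coordinate as $\Phi_k$, where: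 if $I_k$ has endpoints $a<b$ in $\mathbb{R}$, $\Phi_ku=\sqrt{b-a}\,(u\circ\phi_k)$ with $\phi_k(x)=-(x-\tfrac12)a+(x+\tfrac12)b$ on $]-\tfrac12,\tfrac12[$; if $I_k$ has endpoints $a$ and $\infty$, $\Phi_ku=u\circ\phi_k$ with $\phi_k(x)=x+a+\tfrac12$ on $]-\tfrac12,\infty[$; if $I_k$ has endpoints $-\infty$ and $b$, $\Phi_ku=u\circ\phi_k$ with $\phi_k(x)=x+b-\tfrac12$ on $]-\infty,\tfrac12[$. *)

(* Defs.v *)
From HB Require Import structures.
From mathcomp Require Import all_boot all_order all_algebra.
From mathcomp Require Import all_classical all_reals all_analysis.

Set Implicit Arguments.
Unset Strict Implicit.
Unset Printing Implicit Defensive.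

Import Order.TTheory GRing.Theory Num.Theory.
Import numFieldNormedType.Exports.

Local Open Scope classical_set_scope.
Local Open Scope ring_scope.

(* L^2(J), as the library's L^2 space of the Lebesgue measure restricted to J:
   elements are classes of functions R -> R modulo equality a.e. on J. An
   element coerces to a representative, whose values outside J are
   meaningless, so every definition below only looks at its values on J.
   Being a bare quotient, the library's type has no vector space structure;
   linearity is therefore expressed through a.e. identities. *)
Definition L2 (R : realType) (J : interval R) : Type :=
  LspaceType2 (mrestr lebesgue_measure (measurable_itv J)).

(* The direct sum of the L^2(J k), k < p. *)
Definition L2sum (R : realType) (p : nat) (J : 'I_p -> interval R) : Type :=
  forall k, L2 (J k).

Definition fun_of_L2 (R : realType) (J : interval R) (u : L2 J) : R -> R := u.
Coercion fun_of_L2 : L2 >-> Funclass.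

Definition inner (R : realType) (p : nat) (J : 'I_p -> interval R)
    (u v : L2sum J) : R :=
  \sum_k (\int[lebesgue_measure]_(x in [set` J k]) (u k x * v k x)).

Definition norm (R : realType) (p : nat) (J : 'I_p -> interval R)
    (u : L2sum J) : R := Num.sqrt (inner u u).

Section everywhere_defined_operators.
Context (R : realType) (p q : nat).
Context (J : 'I_p -> interval R) (J' : 'I_q -> interval R).
Implicit Types V : L2sum J -> L2sum J'.

Definition lincomb (r : nat) (K : 'I_r -> interval R)
    (a : R) (u : L2sum K) (b : R) (v w : L2sum K) : Prop :=
  forall k, fun_of_L2 (w k) = (fun x => a * u k x + b * v k x)
            %[ae lebesgue_measure in [set` K k]].

Definition linear_op V : Prop := forall a b (u v w : L2sum J),
  lincomb a u b v w -> lincomb a (V u) b (V v) (V w).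

Definition bounded_op V : Prop := exists C : R, forall u, norm (V u) <= C * norm u.

Definition adjoint V (Vs : L2sum J' -> L2sum J) : Prop :=
  forall u v, inner (V u) v = inner u (Vs v).

End everywhere_defined_operators.

Definition invertible_op (R : realType) (p q : nat)
    (J : 'I_p -> interval R) (J' : 'I_q -> interval R)
    (V : L2sum J -> L2sum J') : Prop :=
  exists W : L2sum J' -> L2sum J,
    [/\ linear_op W, bounded_op W, cancel V W & cancel W V].

(* Possibly not everywhere defined operators are represented by their graph, so
   that an equation between such operators includes equality of the domains.
   The composite T S is T \; S. *)
Definition operator (X Y : Type) := set (X * Y).

Definition op_graph (X Y : Type) (f : X -> Y) : operator X Y :=
  [set xy | xy.2 = f xy.1].

(* v_j = sum_k P_jk u_k, all functions being extended by zero to the line. The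
   domain consists of those u for which the right-hand side lies in the direct
   sum of the L^2(J' j). *)
Definition mx_op (R : realType) (p q : nat)
    (J : 'I_p -> interval R) (J' : 'I_q -> interval R) (P : 'M[R]_(q, p)) :
    operator (L2sum J) (L2sum J') :=
  [set uv : L2sum J * L2sum J' | forall j,
    fun_of_L2 (uv.2 j) \_ [set` J' j]
    = (fun x => \sum_k P j k * (fun_of_L2 (uv.1 k) \_ [set` J k]) x)
    %[ae lebesgue_measure]].
Arguments mx_op {R p q} J J' P.

(* For J' = J: P leaves the direct sum of the L^2(J k) invariant. *)
Definition compatible (R : realType) (p q : nat)
    (J : 'I_p -> interval R) (J' : 'I_q -> interval R) (P : 'M[R]_(q, p)) :
    Prop :=
  forall u : L2sum J, exists v : L2sum J', mx_op J J' P (u, v).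

(* The test functions C_c^oo(interior of J), extended by zero. *)
Definition test_function (R : realType) (J : interval R) (f : R -> R) : Prop :=
  (forall n x, derivable (derive1n n f) x 1) /\
  exists K : set R, [/\ compact K, K `<=` [set` J]° &
                        forall x, ~ K x -> f x = 0].

Definition weak_derivative (R : realType) (J : interval R) (u g : L2 J) : Prop :=
  forall f, test_function J f ->
    \int[lebesgue_measure]_(x in [set` J]) (u x * derive1 f x)
    = - \int[lebesgue_measure]_(x in [set` J]) (g x * f x).

Definition H1 (R : realType) (p : nat) (J : 'I_p -> interval R) :
    set (L2sum J) :=
  [set u | forall k, exists g : L2 (J k), weak_derivative (u k) g].

Definition ddx (R : realType) (p : nat) (J : 'I_p -> interval R) :
    operator (L2sum J) (L2sum J) :=
  [set ug | H1 ug.1 /\ forall k, weak_derivative (ug.1 k) (ug.2 k)].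
Arguments ddx {R p} J.

(* The three blocks of L^2(n, m_+, m_-). *)
Definition std_itv (R : realType) (n mp mm : nat) (j : 'I_(n + mp + mm)) :
    interval R :=
  match fintype.split j with
  | inl i => match fintype.split i with
             | inl _ => `](- 2^-1), 2^-1[
             | inr _ => `](- 2^-1), +oo[
             end
  | inr _ => `]-oo, 2^-1[
  end.
Arguments std_itv : clear implicits.

Section Psi.
Context (R : realType) (N : nat) (I : 'I_N -> interval R).

(* For intervals with nonempty interior and nonempty complement, exactly one of
   the following three predicates holds. *)
Definition bounded_itv (J : interval R) : bool :=
  if J is Interval (BSide _ _) (BSide _ _) then true else false.
Definition upper_unbounded_itv (J : interval R) : bool :=
  if J is Interval (BSide _ _) (BInfty _) then true else false.
Definition lower_unbounded_itv (J : interval R) : bool :=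
  if J is Interval (BInfty _) (BSide _ _) then true else false.

Definition bnd_idx : {set 'I_N} := [set k | bounded_itv (I k)]%SET.
Definition up_idx : {set 'I_N} := [set k | upper_unbounded_itv (I k)]%SET.
Definition low_idx : {set 'I_N} := [set k | lower_unbounded_itv (I k)]%SET.

Definition Psi_itv : 'I_(#|bnd_idx| + #|up_idx| + #|low_idx|) -> interval R :=
  std_itv R #|bnd_idx| #|up_idx| #|low_idx|.

(* The j-th index in the order: bounded, sup = oo, inf = -oo. *)
Definition Psi_idx (j : 'I_(#|bnd_idx| + #|up_idx| + #|low_idx|)) : 'I_N :=
  match fintype.split j with
  | inl i => match fintype.split i with
             | inl i' => enum_val i'
             | inr i' => enum_val i'
             end
  | inr i => enum_val i
  end.

Definition Phi_map (J : interval R) (x : R) : R :=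
  match J with
  | Interval (BSide _ a) (BSide _ b) => - (x - 2^-1) * a + (x + 2^-1) * b
  | Interval (BSide _ a) (BInfty _) => x + a + 2^-1
  | Interval (BInfty _) (BSide _ b) => x + b - 2^-1
  | _ => x (* the whole line or an empty interval *)
  end.

Definition Phi_factor (J : interval R) : R :=
  if J is Interval (BSide _ a) (BSide _ b) then Num.sqrt (b - a) else 1.

Definition Psi : operator (L2sum I) (L2sum Psi_itv) :=
  [set uv : L2sum I * L2sum Psi_itv | forall j, fun_of_L2 (uv.2 j) =
     (fun x => Phi_factor (I (Psi_idx j)) *
               uv.1 (Psi_idx j) (Phi_map (I (Psi_idx j)) x))
     %[ae lebesgue_measure in [set` Psi_itv j]]].

End Psi.
Arguments Psi_itv {R N} I j.
Arguments Psi {R N} I.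

Definition flip_bound (R : realType) (b : itv_bound R) : itv_bound R :=
  match b with
  | BSide c x => BSide (~~ c) (- x)
  | BInfty c => BInfty R (~~ c)
  end.

(* -J if s is true and J otherwise. *)
Definition flip_itv (R : realType) (s : bool) (J : interval R) : interval R :=
  if s then let: Interval a b := J in Interval (flip_bound b) (flip_bound a)
  else J.

(* The diagonal operator with the reflection u |-> u(- .) in the coordinates k
   such that s k, and the identity in the others. *)
Definition reflection_op (R : realType) (p : nat) (J : 'I_p -> interval R)
    (s : 'I_p -> bool) :
    operator (L2sum J) (L2sum (fun k => flip_itv (s k) (J k))) :=
  [set uv : L2sum J * L2sum (fun k => flip_itv (s k) (J k)) |
   forall k, fun_of_L2 (uv.2 k) =
     (fun x => uv.1 k (if s k then - x else x))
     %[ae lebesgue_measure in [set` flip_itv (s k) (J k)]]].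
Arguments reflection_op {R p} J s.

(* V is a product of constant matrices, of Psi and of a diagonal operator of
   identities and reflections. A matrix is allowed in each position, and may be
   the identity. *)
Definition matrix_Psi_reflection_product (R : realType) (N q : nat)
    (I : 'I_N -> interval R) (J : 'I_q -> interval R)
    (V : L2sum I -> L2sum J) : Prop :=
  exists (M1 : 'M[R]_N) (M2 : 'M[R]_(#|bnd_idx I| + #|up_idx I| + #|low_idx I|))
    (s : 'I_(#|bnd_idx I| + #|up_idx I| + #|low_idx I|) -> bool)
    (M3 : 'M[R]_(q, #|bnd_idx I| + #|up_idx I| + #|low_idx I|)),
    let K := Psi_itv I in
    let K' := fun k => flip_itv (s k) (K k) in
    [/\ compatible I I M1, compatible K K M2, compatible K' J M3 &
      op_graph V = (mx_op K' J M3 \; (reflection_op K s \;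
                     (mx_op K K M2 \; (Psi I \; mx_op I I M1))))%relation].

(* Main.v *)
Require Import Defs.
From HB Require Import structures.
From mathcomp Require Import all_boot all_order all_algebra.
From mathcomp Require Import all_classical all_reals all_analysis.
From mathcomp Require Import measurable_realfun ring lra.

Set Implicit Arguments.
Unset Strict Implicit.
Unset Printing Implicit Defensive.

Import Order.TTheory GRing.Theory Num.Theory.
Import numFieldNormedType.Exports.

Local Open Scope classical_set_scope.
Local Open Scope ring_scope.

(* Testing compatibility on indicator functions shows that (P1)_jk <> 0 forces I_k
   and I_j to have the same interior, so P1 is block diagonal with respect to the
   classes of intervals with equal endpoints. Within a block, all intervals are
   mapped to a standard interval by the same affine map, which turns d/dx into a
   positive multiple of d/dx. Completing squares block by block gives an
   invertible B with B P1 A^-2 B^T = diag(+1, -1), A being the diagonal matrix of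
   the lengths (and 1 for half-lines). Hence conjugation with B and Psi reduces
   P1 d/dx to a direct sum of operators +d/dx and -d/dx, and reflecting the
   coordinates with sign -1 removes the signs. All operators involved are matrices
   combined with affine changes of variables, so the identities between them
   reduce to identities between matrices. *)

(** * Elements of L^2 *)

(** The exponent -2 collects two effects of a chart of slope a: substitution in the inner product
    puts a factor 1/a into the matrix of V^*, and the chain rule for d V^* adds another one. On the
    target side the slopes are signs. Their absolute values drop out of the adjoint, but the chain
    rule keeps the sign, and this is what a reflection contributes.

    Diagonalization has to stay inside the blocks, since a row of B mixing functions on different
    intervals would have no meaning. Elimination by congruences respects this: it adds multiples of
    row j only to rows linked to j by a nonzero entry.

    Two points shape the statements. Equal endpoints do not make two intervals equal, so matching is
    expressed by interiors and identities hold almost everywhere. Equality of unbounded operators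
    includes equality of domains, so both V^* and its inverse have to map H^1 into H^1.

    A reflection exchanges the two kinds of half-lines, so m_+ and m_- depend on the signs as well
    as on the intervals. *)

Section L2_elements.
Context (R : realType).
Local Notation mu := (@lebesgue_measure R).
Implicit Types (J : interval R) (f g : R -> R).

(** Measurability is asked on the whole line, as for the representatives of a class; only the
    integral is confined to [J]. *)
Definition square_integrable J f : Prop :=
  measurable_fun setT f /\ mu.-integrable [set` J] (fun x => (f x ^+ 2)%:E).

(* [filterS] and [filterS2] themselves do not unify the type of reals with the
   copy of it carried by [lebesgue_measure]. *)
Lemma ae_imply (P Q : R -> Prop) : (forall x, P x -> Q x) ->
  (\forall x \ae mu, P x) -> \forall x \ae mu, Q x.
Proof. by move=> PQ; apply: (@filterS _ _ (ae_filter_ringOfSetsType _)). Qed.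

Lemma ae_imply2 (P Q S : R -> Prop) : (forall x, P x -> Q x -> S x) ->
  (\forall x \ae mu, P x) -> (\forall x \ae mu, Q x) -> \forall x \ae mu, S x.
Proof. by move=> PQS; apply: (@filterS2 _ _ (ae_filter_ringOfSetsType _)). Qed.

Lemma ae_mrestrP J (P : R -> Prop) :
  (\forall x \ae mrestr mu (measurable_itv J), P x) <->
  (\forall x \ae mu, [set` J] x -> P x).
Proof.
split=> -[N [mN N0 PN]].
  exists (N `&` [set` J]); split => //; first exact: measurableI.
  by move=> x /= /not_implyP[Jx Px]; split => //; exact: PN.
exists (N `|` ~` [set` J]); split.
- exact/measurableU/measurableC.
- rewrite /= /mrestr setIUl setICl setU0.
  by apply: (subset_measure0 _ mN _ N0) => //; exact: measurableI.
- move=> x /= Px; have [Jx|] := pselect ([set` J] x); last by right.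
  by left; apply: PN => /= /(_ Jx).
Qed.

Lemma ge0_integral_mrestr J (f : R -> \bar R) : measurable_fun setT f ->
  (forall x, 0 <= f x)%E ->
  (\int[mrestr mu (measurable_itv J)]_x f x = \int[mu]_(x in [set` J]) f x)%E.
Proof.
move=> mf f0.
have -> : (\int[mu]_(x in [set` J]) f x
    = \int[mrestr mu (measurable_itv J)]_(x in [set` J]) f x)%E.
  by apply: eq_measure_integral => A mA AJ; rewrite /= /mrestr setIidl.
(* The complement of [J] is null for the restricted measure, so cutting [f] off outside [J] changes
   it only on a null set. *)
rewrite [RHS]integral_mkcond; apply: ge0_ae_eq_integral => //.
- by apply/(measurable_restrictT _ _).1 => //; exact: measurable_funTS.
- by move=> x _; apply: erestrict_ge0.
- apply/ae_mrestrP/aeW => x Jx _.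
  by rewrite patchE ifT// inE.
Qed.

Lemma finite_norm_mrestrP J f : measurable_fun setT f ->
  finite_norm (mrestr mu (measurable_itv J)) 2%:E f <-> square_integrable J f.
Proof.
move=> mf; rewrite /finite_norm unlock.
under eq_integral do rewrite /= powR_mulrn// real_normK ?num_real//.
rewrite ge0_integral_mrestr//; last 2 first.
- by apply/measurable_EFinP; exact: measurable_funX.
- by move=> x; rewrite lee_fin sqr_ge0.
have mf2 : measurable_fun [set` J] (fun x => (f x ^+ 2)%:E).
  by apply/measurable_EFinP/measurable_funX; exact: measurable_funTS.
split=> [fin|[_ /integrableP[_]]].
  split=> //; apply/integrableP; split => //.
  under eq_integral do rewrite gee0_abs ?lee_fin ?sqr_ge0//.
  by apply: (@lty_poweRy _ _ 2^-1).
under eq_integral do rewrite gee0_abs ?lee_fin ?sqr_ge0//.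
exact: poweR_lty.
Qed.

Section representatives.
Context (J : interval R).
Implicit Types u v : L2 J.

Lemma measurable_L2 u : measurable_fun setT (fun_of_L2 u).
Proof.
have mu' : @measurable_fun _ _ (measurableTypeR R) (measurableTypeR R) setT (fun_of_L2 u).
  exact: (@measurable_funPT _ _ _ _ (repr (LebesgueSpace.sort u))).
exact: mu'.
Qed.

Lemma square_integrable_L2 u : square_integrable J u.
Proof.
apply: (finite_norm_mrestrP _ (measurable_L2 u)).1.
exact: (@Lebesgue_finite _ _ _ _ _ _ u).
Qed.

(** An element of [L2 J] is a class paired with a proof that its norm is finite; proof irrelevance
    reduces equality to that of the classes. *)
Lemma L2_eqP u v : (fun_of_L2 u = v %[ae mu in [set` J]]) <-> u = v.
Proof.
split=> [uv|->]; last exact: aeW.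
have : LebesgueSpace.sort u = LebesgueSpace.sort v.
  rewrite -[LHS]reprK -[RHS]reprK; apply/eqquotP/asboolP.
  have uv' : \forall x \ae mu, [set` J] x -> setT x -> fun_of_L2 u x = v x.
    by apply: ae_imply uv => x uvx /uvx.
  by apply/ae_mrestrP; exact: uv'.
case: u uv => u [[pu]] _; case: v => v [[pv]] /= uv.
by rewrite uv in pu *; congr LebesgueSpace.Pack; congr LebesgueSpace.Class;
  congr isFinLebesgue.Axioms_; exact: Prop_irrelevance.
Qed.

Lemma exists_L2 f : square_integrable J f ->
  exists u : L2 J, fun_of_L2 u = f %[ae mu in [set` J]].
Proof.
move=> sqf; have mf := sqf.1.
pose fm : {mfun measurableTypeR R >-> measurableTypeR R} := HB.pack f
  (isMeasurableFun.Build _ _ (measurableTypeR R) (measurableTypeR R) f mf).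
pose T := {mfun_ mrestr mu (measurable_itv J),
  measurableTypeR R >-> measurableTypeR R}.
pose fq := \pi_T%qT fm.
have fqf : repr fq = f %[ae mu in [set` J]].
  have /eqquotP/asboolP/ae_mrestrP : repr fq = fm %[mod T]%qT
    by rewrite reprK.
  by apply: ae_imply => x h /h; apply.
(* Finiteness concerns the representative chosen for the class of [f], so it is carried over from
   [f] by equality almost everywhere. *)
have fin : finite_norm (mrestr mu (measurable_itv J)) 2%:E (repr fq).
  have mfq : measurable_fun setT (repr fq : R -> R).
    have mfq' : @measurable_fun _ _ (measurableTypeR R) (measurableTypeR R) setT (repr fq).
      exact: (@measurable_funPT _ _ _ _ (repr fq)).
    exact: mfq'.
  apply/finite_norm_mrestrP => //; split=> //.
  apply/integrableP; split.
    by apply/measurable_EFinP/measurable_funX; exact: measurable_funTS.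
  case: sqf => _ /integrableP[_]; congr (_ < _)%E.
  apply: ae_eq_integral => //.
  - by do 2 apply: measurableT_comp => //; exact/measurable_funX/measurable_funTS.
  - by do 2 apply: measurableT_comp => //; exact/measurable_funX/measurable_funTS.
  - by apply: ae_imply fqf => x /[apply] ->.
by exists (LebesgueSpace.Pack (LebesgueSpace.Class
  (@isFinLebesgue.Axioms_ _ _ _ _ _ (lee1n 2) fq fin))).
Qed.

End representatives.

End L2_elements.

(** * Affine changes of variables *)

Record affine_map (R : realType) :=
  AffineMap { slope : R; shift : R; slope_neq0 : slope != 0 }.

Definition affine_fun (R : realType) (c : affine_map R) (x : R) : R :=
  slope c * x + shift c.
Coercion affine_fun : affine_map >-> Funclass.

Section affine_maps.
Context (R : realType).
Implicit Types c d : affine_map R.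

Lemma affine_map_eq c d : slope c = slope d -> shift c = shift d -> c = d.
Proof.
case: c d => [a b a0] [a' b' a0'] /= aa' bb'; subst.
by congr AffineMap; exact: bool_irrelevance.
Qed.

Lemma affine_inv_subproof c : (slope c)^-1 != 0.
Proof. by rewrite invr_eq0 slope_neq0. Qed.

Definition affine_inv c :=
  AffineMap (- ((slope c)^-1 * shift c)) (affine_inv_subproof c).

Lemma affine_comp_subproof c d : slope c * slope d != 0.
Proof. by rewrite mulf_neq0 ?slope_neq0. Qed.

Definition affine_comp c d :=
  AffineMap (slope c * shift d + shift c) (affine_comp_subproof c d).

Lemma affine_compE c d x : affine_comp c d x = c (d x).
Proof. by rewrite /affine_fun/= mulrDr mulrA addrA. Qed.

Lemma affine_invK c : cancel c (affine_inv c).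
Proof. by move=> x; rewrite /affine_fun/= mulrDr mulKf ?slope_neq0// addrK. Qed.

Lemma affine_invKV c : cancel (affine_inv c) c.
Proof. by move=> x; rewrite /affine_fun/= mulrBr !mulVKf ?slope_neq0// subrK. Qed.

Lemma measurable_affine c : measurable_fun setT c.
Proof. by apply: measurable_funD => //; exact: measurable_funM. Qed.

Lemma continuous_affine c : continuous c.
Proof. by move=> x; apply: cvgD; [apply: cvgM => //; exact: cvg_cst|exact: cvg_cst]. Qed.

Lemma affine_lt_pos c x y : 0 < slope c -> (c x < c y) = (x < y).
Proof. by move=> c0; rewrite /affine_fun ltrD2r ltr_pM2l. Qed.

Lemma affine_lt_neg c x y : slope c < 0 -> (c x < c y) = (y < x).
Proof. by move=> c0; rewrite /affine_fun ltrD2r ltr_nM2l. Qed.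

End affine_maps.

Section change_of_variables.
Context (R : realType).
Local Notation mu := (@lebesgue_measure R).
Implicit Types (c : affine_map R) (J : interval R).

Let measurable_affineR c :
  @measurable_fun _ _ (measurableTypeR R) (measurableTypeR R) setT c.
Proof. exact: measurable_affine. Qed.

(** The right-hand side is a measure in [A], so by uniqueness it is enough to compare both sides on
    half-open intervals. For a negative slope the preimage of such an interval is half-open on the
    other side. *)
Lemma lebesgue_measure_affine c (A : set R) : measurable A ->
  (mu A = `|slope c|%:E * mu (c @^-1` A))%E.
Proof.
move=> mA.
pose k : {nonneg R} := NngNum (normr_ge0 (slope c)).
pose nu : {measure set (measurableTypeR R) -> \bar R} :=
  mscale k (pushforward mu (affine_fun c : measurableTypeR R -> measurableTypeR R)).
rewrite (@lebesgue_measure_unique R (nu (measurable_affineR c)))// => _ [[a b]] _ <-.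
rewrite /nu /= /mscale /=.
have ca0 := slope_neq0 c.
have [c0|c0|] := ltrgt0P (slope c); last by move/eqP; rewrite (negPf ca0).
- rewrite (_ : pushforward _ _ _ = mu `](affine_inv c a), (affine_inv c b)]%classic); last first.
    congr (mu _).
    rewrite predeqE => x /=; rewrite !in_itv/=.
    suff -> : (a < c x <= b) = (affine_inv c a < x <= affine_inv c b) by [].
    rewrite -[a in LHS](affine_invKV c) -[b in LHS](affine_invKV c).
    by rewrite !leNgt !affine_lt_pos.
  rewrite !lebesgue_measure_itv/= !lte_fin /affine_fun/= ltrD2r ltr_pM2l ?invr_gt0//.
  case: ifP => _; rewrite ?mule0// -!EFinD -EFinM; congr EFin.
  by field.
- rewrite (_ : pushforward _ _ _ = mu `[(affine_inv c b), (affine_inv c a)[%classic); last first.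
    congr (mu _).
    rewrite predeqE => x /=; rewrite !in_itv/=.
    suff -> : (a < c x <= b) = (affine_inv c b <= x < affine_inv c a) by [].
    rewrite -[a in LHS](affine_invKV c) -[b in LHS](affine_invKV c).
    by rewrite !leNgt !affine_lt_neg// andbC.
  rewrite !lebesgue_measure_itv/= !lte_fin /affine_fun/= ltrD2r ltr_nM2l ?invr_lt0//.
  case: ifP => _; rewrite ?mule0// -!EFinD -EFinM; congr EFin.
  by field.
Qed.

Lemma ge0_integral_affine c (D : set R) (f : R -> \bar R) :
  measurable D -> measurable_fun setT f -> (forall x, 0 <= f x)%E ->
  (\int[mu]_(x in D) f x = `|slope c|%:E * \int[mu]_(x in c @^-1` D) f (c x))%E.
Proof.
move=> mD mf f0.
pose k : {nonneg R} := NngNum (normr_ge0 (slope c)).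
pose nu : {measure set (measurableTypeR R) -> \bar R} :=
  (pushforward mu (affine_fun c : measurableTypeR R -> measurableTypeR R)).
have mfD : measurable_fun D f by exact: measurable_funTS.
rewrite -[X in _ = (_ * X)%E](ge0_integral_pushforward (measurable_affineR c))//.
rewrite -(@ge0_integral_mscale _ _ _ (nu (measurable_affineR c)) _ mD k)//.
by apply: eq_measure_integral => A mA AD; exact: lebesgue_measure_affine.
Qed.

(** A real integral is [fine] of the difference of the integrals of the positive and negative parts.
    Infinite [x] or [y] cover functions that are not integrable; both sides are then 0. *)
Lemma fine_gt0_muleB (k : R) (x y : \bar R) : 0 < k ->
  fine (k%:E * x - k%:E * y) = k * fine (x - y).
Proof.
move=> k0; case: x => [x| |]; case: y => [y| |] /=;
  rewrite ?gt0_muley ?gt0_muleNy ?lte_fin//= ?mulr0//.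
by rewrite mulrBr.
Qed.

Lemma Rintegral_affine c (D : set R) (f : R -> R) :
  measurable D -> measurable_fun setT f ->
  \int[mu]_(x in D) f x = `|slope c| * \int[mu]_(x in c @^-1` D) f (c x).
Proof.
move=> mD mf; rewrite /Rintegral integralE.
rewrite (ge0_integral_affine c mD)//; last exact/measurable_funepos/measurable_EFinP.
rewrite (ge0_integral_affine c mD)//; last exact/measurable_funeneg/measurable_EFinP.
rewrite [X in _ = _ * fine X]integralE.
rewrite fine_gt0_muleB ?normr_gt0 ?slope_neq0//.
by congr (_ * fine (_ - _)); apply: eq_integral => x _; rewrite ?funeposE ?funenegE.
Qed.

Lemma ae_affine c (P : R -> Prop) :
  (\forall x \ae mu, P x) -> \forall x \ae mu, P (c x).
Proof.
move=> [N [mN N0 PN]]; exists (c @^-1` N); split => //.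
- by rewrite -[X in measurable X]setTI; exact: measurable_affine.
- have := lebesgue_measure_affine c mN.
  rewrite N0 => /esym/eqP; rewrite mule_eq0 => /orP[|/eqP//].
  by rewrite eqe normr_eq0 (negPf (slope_neq0 c)).
- by move=> x /= Px; exact: PN.
Qed.

Lemma measurable_interior_itv J : measurable ([set` J]° : set R).
Proof. by apply: open_measurable; exact: open_interior. Qed.

(** Only endpoints can be missing from the interior, so the difference is finite. *)
Lemma itv_interior_null J : mu ([set` J] `\` [set` J]°) = 0%E.
Proof.
apply: countable_lebesgue_measure0.
suff [s sJ] : exists s : seq R, [set` J] `\` [set` J]° `<=` [set` s].
  apply: (sub_countable (subset_card_le sJ)).
  exact/finite_set_countable/finite_seq.
case: J => [[x a|[|]] [y b|[|]]].
- exists [:: a; b] => z [/= zJ]; rewrite interior_itv_bnd /= in_itv/= !inE.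
  have /andP[az zb] : (a <= z) && (z <= b).
    by case: x y zJ => -[] /itvP zab; rewrite !zab.
  move=> /negP; rewrite negb_and -!leNgt.
  by case/orP => h; apply/orP; [left|right]; rewrite eq_le h ?az ?zb.
- by exists [::] => z [/=]; rewrite in_itv/= andbF.
- exists [:: a] => z [/= zJ]; rewrite interior_itv_bndy /= in_itv/= !inE andbT.
  have az : a <= z by case: x zJ => /itvP za; rewrite za.
  by move=> /negP; rewrite -leNgt => h; rewrite eq_le h az.
- exists [:: b] => z [/= zJ]; rewrite interior_itv_Nybnd /= in_itv/= !inE.
  have zb : z <= b by case: y zJ => /itvP zb; rewrite zb.
  by move=> /negP; rewrite -leNgt => h; rewrite eq_le h zb.
- by exists [::] => z [/=]; rewrite in_itv.
- by exists [::] => z [/= _]; rewrite interior_itv_Nyy/= in_itv/= => /(_ isT).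
- by exists [::] => z [/=]; rewrite in_itv.
- by exists [::] => z [/=]; rewrite in_itv.
- by exists [::] => z [/=]; rewrite in_itv.
Qed.

Lemma ae_interior J : \forall x \ae mu, [set` J] x <-> [set` J]° x.
Proof.
exists ([set` J] `\` [set` J]°); split.
- by apply: measurableD; [exact: measurable_itv|exact: measurable_interior_itv].
- exact: itv_interior_null.
- move=> x /= nJx; apply: contrapT => nx; apply: nJx; split.
    by move=> Jx; apply: contrapT => nJx; apply: nx.
  exact: interior_subset.
Qed.

Lemma ae_eq_sets_integral (A B : set R) (f : R -> \bar R) :
  measurable A -> measurable B -> measurable_fun setT f ->
  (\forall x \ae mu, A x <-> B x) ->
  (\int[mu]_(x in A) f x = \int[mu]_(x in B) f x)%E.
Proof.
move=> mA mB mf AB; rewrite integral_mkcond [RHS]integral_mkcond.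
apply: ae_eq_integral => //.
- by apply/(measurable_restrictT _ _).1 => //; exact: measurable_funTS.
- by apply/(measurable_restrictT _ _).1 => //; exact: measurable_funTS.
- apply: ae_imply AB => x AB _; rewrite !patchE.
  by congr (if _ then _ else _); apply/idP/idP; rewrite !inE => /AB.
Qed.

Section matching_intervals.
Context (c : affine_map R) (J J' : interval R).
Hypothesis cJ : forall x, [set` J]° (c x) <-> [set` J']° x.

(** [cJ] leaves open which endpoints belong to the intervals; these form null sets, and [c] pulls
    null sets back to null sets. *)
Lemma ae_matching_itv : \forall x \ae mu, [set` J] (c x) <-> [set` J'] x.
Proof.
have := ae_affine c (ae_interior J).
by apply: ae_imply2 (ae_interior J') => x [a b] [a' b']; split=> /[dup];
  [move=> /a' /cJ /b|move=> /a /cJ /b'].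
Qed.

Lemma ae_affine_itv (P : R -> Prop) :
  (\forall x \ae mu, [set` J] x -> P x) ->
  \forall x \ae mu, [set` J'] x -> P (c x).
Proof.
move=> /ae_affine-/(_ c); apply: ae_imply2 ae_matching_itv.
by move=> x cJJ + /cJJ; apply.
Qed.

Lemma ge0_integral_affine_itv (f : R -> \bar R) :
  measurable_fun setT f -> (forall x, 0 <= f x)%E ->
  (\int[mu]_(x in [set` J]) f x
   = `|slope c|%:E * \int[mu]_(x in [set` J']) f (c x))%E.
Proof.
move=> mf f0; rewrite (ge0_integral_affine c)//; congr (_ * _)%E.
apply: ae_eq_sets_integral ae_matching_itv => //.
- by rewrite -[X in measurable X]setTI; apply: measurable_affine => //; exact: measurable_itv.
- by apply: measurableT_comp => //; exact: measurable_affine.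
Qed.

Lemma Rintegral_affine_itv (f : R -> R) : measurable_fun setT f ->
  \int[mu]_(x in [set` J]) f x
  = `|slope c| * \int[mu]_(x in [set` J']) f (c x).
Proof.
move=> mf; rewrite (Rintegral_affine c)//; congr (_ * fine _).
apply: ae_eq_sets_integral ae_matching_itv => //.
- by rewrite -[X in measurable X]setTI; apply: measurable_affine => //; exact: measurable_itv.
- by apply/measurable_EFinP/measurableT_comp => //; exact: measurable_affine.
Qed.

Lemma square_integrable_affine (f : R -> R) :
  square_integrable J f -> square_integrable J' (f \o c).
Proof.
move=> [mf /integrableP[_ foo]].
have mfc : measurable_fun setT (f \o c).
  by apply: measurableT_comp => //; exact: measurable_affine.
split=> //; apply/integrableP; split.
  by apply/measurable_EFinP/measurable_funX; exact: measurable_funTS.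
move: foo; rewrite ge0_integral_affine_itv//; last first.
  by do 2 apply: measurableT_comp => //; exact: measurable_funX.
rewrite ltey => /eqP foo; rewrite ltey; apply/eqP => oo; apply: foo.
by rewrite /= oo gt0_muley// lte_fin normr_gt0 slope_neq0.
Qed.

End matching_intervals.

End change_of_variables.

(** * Square integrable functions and test functions *)

Section square_integrable_functions.
Context (R : realType).
Local Notation mu := (@lebesgue_measure R).
Implicit Types (J : interval R) (f g : R -> R).

Let mitv J : @measurable _ (measurableTypeR R) [set` J] := measurable_itv J.

Lemma square_integrable0 J : square_integrable J (fun=> 0).
Proof.
split; first exact: measurable_cst.
apply: (eq_integrable _ (cst 0%E)) => [|x _|]; [exact: mitv| |].
  by rewrite expr0n.
exact: integrable0.
Qed.

Lemma square_integrableZ J a f :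
  square_integrable J f -> square_integrable J (fun x => a * f x).
Proof.
move=> [mf if2]; split; first exact: measurable_funM.
have mJ := mitv J.
have := integrableZl mJ (a ^+ 2) if2; apply: eq_integrable => // x _.
by rewrite exprMn EFinM.
Qed.

(** Domination by 2 (f^2 + g^2), which exceeds (f + g)^2 by (f - g)^2. *)
Lemma square_integrableD J f g : square_integrable J f -> square_integrable J g ->
  square_integrable J (fun x => f x + g x).
Proof.
move=> [mf if2] [mg ig2]; split; first exact: measurable_funD.
have mJ := mitv J.
have /(integrableZl mJ 2) := integrableD mJ if2 ig2.
apply: le_integrable => //.
  by apply/measurable_EFinP/measurable_funX/measurable_funD; exact: measurable_funTS.
move=> x _; rewrite /= lee_fin.
have p : 0 <= 2 * (f x ^+ 2 + g x ^+ 2) by rewrite mulr_ge0// addr_ge0// sqr_ge0.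
rewrite (ger0_norm p) ger0_norm ?sqr_ge0//.
by have := sqr_ge0 (f x - g x); nra.
Qed.

Lemma square_integrable_sum J (n : nat) (F : 'I_n -> R -> R) :
  (forall k, square_integrable J (F k)) ->
  square_integrable J (fun x => \sum_k F k x).
Proof.
move=> sF; elim: n F sF => [|n IHn] F sF.
  under eq_fun do rewrite big_ord0; exact: square_integrable0.
under eq_fun do rewrite big_ord_recr/=.
by apply: square_integrableD => //; exact: IHn.
Qed.

(** Each added term costs a factor 2 through (S + z)^2 <= 2 S^2 + 2 z^2, hence the constant 2^n. *)
Lemma sqr_sum_le (n : nat) (y : 'I_n -> R) :
  (\sum_k y k) ^+ 2 <= 2 ^+ n * \sum_k y k ^+ 2.
Proof.
elim: n y => [|n IHn] y; first by rewrite !big_ord0 expr0n mulr0.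
rewrite !big_ord_recr/=.
have := IHn (fun k => y (widen_ord (leqnSn n) k)).
have : 0 <= \sum_(k < n) y (widen_ord (leqnSn n) k) ^+ 2.
  by apply: sumr_ge0 => k _; exact: sqr_ge0.
move: (\sum_(k < n) y _) (\sum_(k < n) y _ ^+ 2) (y ord_max) => S Q z Q0 SQ.
have p1 : 1 <= 2 ^+ n :> R by rewrite exprn_ege1// ler1n.
rewrite [2 ^+ n.+1]exprS.
have : z ^+ 2 <= 2 ^+ n * z ^+ 2 by rewrite ler_peMl ?sqr_ge0.
have := sqr_ge0 (S - z); move: (2 ^+ n) SQ {p1} => P; nra.
Qed.

Lemma integrable_mul J f g : square_integrable J f -> square_integrable J g ->
  mu.-integrable [set` J] (fun x => (f x * g x)%:E).
Proof.
move=> [mf if2] [mg ig2].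
have mJ := mitv J.
have := integrableD mJ if2 ig2; apply: le_integrable => //.
  by apply/measurable_EFinP/measurable_funM; exact: measurable_funTS.
move=> x _; rewrite /= lee_fin.
have p : 0 <= f x ^+ 2 + g x ^+ 2 by rewrite addr_ge0// sqr_ge0.
rewrite (ger0_norm p) ler_norml.
by have := sqr_ge0 (f x - g x); have := sqr_ge0 (f x + g x); nra.
Qed.

Lemma integrable_sum_ord J (n : nat) (F : 'I_n -> R -> R) :
  (forall k, mu.-integrable [set` J] (EFin \o F k)) ->
  mu.-integrable [set` J] (fun x => (\sum_k F k x)%:E).
Proof.
have mJ := mitv J; elim: n F => [|n IHn] F iF.
  apply: (eq_integrable mJ (cst 0%E)) => [x _|]; last exact: integrable0.
  by rewrite big_ord0.
have iS := IHn (fun k => F (widen_ord (leqnSn n) k)) (fun k => iF _).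
apply: (eq_integrable mJ _ _ _ (integrableD mJ iS (iF ord_max))) => x _.
by rewrite big_ord_recr.
Qed.

Lemma Rintegral_sum J (n : nat) (F : 'I_n -> R -> R) :
  (forall k, mu.-integrable [set` J] (EFin \o F k)) ->
  \int[mu]_(x in [set` J]) (\sum_k F k x) = \sum_k \int[mu]_(x in [set` J]) F k x.
Proof.
have mJ := mitv J; elim: n F => [|n IHn] F iF.
  have -> : (fun x => \sum_(k < 0) F k x) = cst 0 by apply/funext => x; rewrite big_ord0.
  by rewrite big_ord0 Rintegral_cst// mul0r.
have -> : (fun x => \sum_(k < n.+1) F k x)
    = (fun x => \sum_(k < n) F (widen_ord (leqnSn n) k) x + F ord_max x).
  by apply/funext => x; rewrite big_ord_recr.
rewrite big_ord_recr/= RintegralD ?IHn//.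
exact: integrable_sum_ord.
Qed.

Lemma square_integrable_compact_support J (K : set R) f :
  continuous f -> compact K -> (forall x, ~ K x -> f x = 0) ->
  square_integrable J f.
Proof.
move=> cf cK fK; split; first exact: continuous_measurable_fun.
apply: (integrableS measurableT (mitv J) (@subsetT _ _)).
have mK : @measurable _ (measurableTypeR R) K by exact: compact_measurable.
have -> : (fun x => (f x ^+ 2)%:E) = (fun x => (f x ^+ 2)%:E) \_ K.
  apply/funext => x; rewrite patchE; case: ifPn => // /negP; rewrite inE => /fK ->.
  by rewrite expr0n.
apply: (integrable_mkcond _ mK).1.
apply: (@continuous_compact_integrable R (fun x => f x ^+ 2) K cK).
apply: continuous_subspaceT => x.
by apply: (@continuous_comp _ _ _ f (fun y => y ^+ 2)); [exact: cf|exact: exprn_continuous].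
Qed.

Lemma test_functionP J f : test_function J f ->
  [/\ square_integrable J f, square_integrable J (derive1 f) &
      forall x, derivable f x 1].
Proof.
move=> [df [K [cK KJ f0]]].
have df0 x : derivable f x 1 by exact: (df 0%N).
have cont n : continuous (derive1n n f).
  by move=> x; apply: differentiable_continuous; exact/derivable1_diffP.
split=> //.
- exact: (square_integrable_compact_support J (cont 0%N) cK).
- apply: (square_integrable_compact_support J (cont 1%N) cK) => x Kx.
  (* The complement of the compact set [K] is open, so [f] vanishes near [x] and not just at [x]. *)
  have nf0 : \forall y \near x, f y = cst 0 y.
    have : open (~` K) by apply: closed_openC; exact: compact_closed.
    by move=> /(_ x Kx); apply: filterS => y /f0.
  rewrite /= derive1E.
  rewrite (@near_eq_derive _ R R f (cst 0) x 1 nf0).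
  exact: derive_cst.
Qed.

Lemma is_derive_affine (c : affine_map R) (x : R) : is_derive x 1 c (slope c).
Proof.
rewrite /affine_fun; apply: is_derive_eq.
by rewrite addr0 /GRing.scale/= mulr1.
Qed.

Lemma derive1n_affine (c : affine_map R) f n :
  (forall n x, derivable (derive1n n f) x 1) ->
  derive1n n (f \o c) = (fun x => slope c ^+ n * derive1n n f (c x)).
Proof.
move=> df; elim: n => [|n IHn]; first by apply/funext => x; rewrite mul1r.
apply/funext => x; rewrite derive1nS IHn derive1E.
have dc := is_derive_affine c x.
have dn : is_derive (c x) 1 (derive1n n f) (derive1n n.+1 f (c x)).
  by rewrite derive1nS derive1E; exact: derivableP.
have dnc := is_derive1_comp dn dc.
have -> : (fun x => slope c ^+ n * derive1n n f (c x))
    = slope c ^+ n *: (derive1n n f \o c) by [].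
rewrite deriveZ; last by case: dnc.
by rewrite (@derive_val _ _ _ _ _ _ _ dnc) /GRing.scale/= exprSr -mulrA [slope c * _]mulrC.
Qed.

Lemma test_function_affine (c : affine_map R) J J' f :
  (forall x, [set` J]° (c x) <-> [set` J']° x) ->
  test_function J f -> test_function J' (f \o c).
Proof.
move=> cJ [df [K [cK KJ f0]]]; split.
  move=> n x; rewrite derive1n_affine//.
  have dc := is_derive_affine c x.
  have dn : is_derive (c x) 1 (derive1n n f) (derive1n n.+1 f (c x)).
    by rewrite derive1nS derive1E; exact: derivableP.
  have dnc := is_derive1_comp dn dc.
  by apply: (@derivableZ _ _ _ (derive1n n f \o c)); case: dnc.
(* The preimage of [K], written as an image under the continuous inverse so that it is compact. *)
exists (affine_inv c @` K); split.
- apply: continuous_compact => //; apply: continuous_subspaceT.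
  exact: continuous_affine.
- by move=> _ [x Kx <-]; apply/cJ; rewrite affine_invKV; exact: KJ.
- by move=> x nKx; apply: f0 => Kcx; apply: nKx; exists (c x) => //; rewrite affine_invK.
Qed.

End square_integrable_functions.

(** * Matrix operators in affine charts *)

Section chart_operators.
Context (R : realType).
Local Notation mu := (@lebesgue_measure R).

Let mitv J : @measurable _ (measurableTypeR R) [set` J] := @measurable_itv R J.

Lemma ae_forall (n : nat) (P : 'I_n -> R -> Prop) :
  (forall k, \forall x \ae mu, P k x) -> \forall x \ae mu, forall k, P k x.
Proof. by move=> aP; apply: (@filter_forall _ _ _ _ (ae_filter_ringOfSetsType _)). Qed.

Lemma ae_eq_Rintegral (J : interval R) (f g : R -> R) :
  measurable_fun setT f -> measurable_fun setT g ->
  f = g %[ae mu in [set` J]] ->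
  \int[mu]_(x in [set` J]) f x = \int[mu]_(x in [set` J]) g x.
Proof.
move=> mf mg fg; congr fine; apply: ae_eq_integral.
- exact: mitv.
- by apply/measurable_EFinP; exact: measurable_funTS.
- by apply/measurable_EFinP; exact: measurable_funTS.
- by apply: ae_imply fg => x fg /fg /= ->.
Qed.

(* The class of the zero function if f is not square integrable. *)
Definition to_L2 (J : interval R) (f : R -> R) : L2 J :=
  match pselect (square_integrable J f) with
  | left sf => projT1 (cid (exists_L2 sf))
  | right _ => projT1 (cid (exists_L2 (square_integrable0 J)))
  end.

Lemma to_L2E (J : interval R) f : square_integrable J f ->
  fun_of_L2 (to_L2 J f) = f %[ae mu in [set` J]].
Proof. by rewrite /to_L2 => sf; case: pselect => // {}sf; case: cid. Qed.

Definition transition (c c' : affine_map R) := affine_comp c (affine_inv c').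

Lemma transitionE c c' x : transition c c' x = c (affine_inv c' x).
Proof. exact: affine_compE. Qed.

Section one_operator.
Context (p q : nat) (J : 'I_p -> interval R) (c : 'I_p -> affine_map R)
  (J' : 'I_q -> interval R) (c' : 'I_q -> affine_map R) (C : 'M[R]_(q, p)).

(* Seen through the charts c and c', the matrix C only mixes intervals with the
   same interior. *)
Definition adapted : Prop := forall j k, C j k != 0 ->
  forall x, [set` J k]° (c k x) <-> [set` J' j]° (c' j x).

(* [(chart_op u)_j o c'_j = \sum_k C_jk (u_k o c_k)], so that composition of
   these operators is multiplication of the matrices. *)
Definition chart_sum (u : L2sum J) (j : 'I_q) (x : R) : R :=
  \sum_k C j k * u k (transition (c k) (c' j) x).

Definition chart_op (u : L2sum J) : L2sum J' := fun j =>
  to_L2 (J' j) (chart_sum u j).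

Hypothesis CJ : adapted.

Lemma adapted_transition j k : C j k != 0 ->
  forall x, [set` J k]° (transition (c k) (c' j) x) <-> [set` J' j]° x.
Proof. by move=> /CJ Cjk x; rewrite transitionE Cjk affine_invKV. Qed.

(** Where [C j k] is 0 the transition need not map [J' j] into [J k], and [u k] may be read at
    points where its values are meaningless; the zero coefficient hides them. The same case
    distinction recurs below. *)
Lemma square_integrable_term u j k : square_integrable (J' j)
  (fun x => C j k * fun_of_L2 (u k : L2 (J k)) (transition (c k) (c' j) x)).
Proof.
have [->|Cjk] := eqVneq (C j k) 0.
  by under eq_fun do rewrite mul0r; exact: square_integrable0.
apply: square_integrableZ.
exact: (square_integrable_affine (adapted_transition Cjk) (square_integrable_L2 _)).
Qed.

Lemma chart_opE u j : fun_of_L2 (chart_op u j)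
  = chart_sum u j %[ae mu in [set` J' j]].
Proof. by apply: to_L2E; apply: square_integrable_sum => k; exact: square_integrable_term. Qed.

(** The form in which [mx_op], [Psi] and [reflection_op], all given by identities almost everywhere,
    are recognized as chart operators. *)
Lemma chart_opP u v : (forall j, fun_of_L2 (v j)
    = chart_sum u j %[ae mu in [set` J' j]]) <-> v = chart_op u.
Proof.
split=> [vE|->]; last exact: chart_opE.
apply: functional_extensionality_dep => j; apply/L2_eqP.
by apply: ae_imply2 (vE j) (chart_opE u j) => x v1 v2 Jx; rewrite v1 ?v2.
Qed.

(** Allows an identity known almost everywhere to be used inside [chart_sum], behind the
    transitions. *)
Lemma ae_pullback (P : 'I_p -> R -> Prop) j :
  (forall k, \forall x \ae mu, [set` J k] x -> P k x) ->
  \forall x \ae mu, [set` J' j] x ->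
    forall k, C j k != 0 -> P k (transition (c k) (c' j) x).
Proof.
move=> aP.
have : \forall x \ae mu, forall k, C j k != 0 -> [set` J' j] x ->
    P k (transition (c k) (c' j) x).
  apply: ae_forall => k; have [C0|Cjk] := eqVneq (C j k) 0; first exact: aeW.
  by apply: ae_imply (ae_affine_itv (adapted_transition Cjk) (aP k)) => x h _.
by apply: ae_imply => x h Jx k Cjk; exact: h.
Qed.

Lemma eq_sum_neq0 (j : 'I_q) (f g : 'I_p -> R) :
  (forall k, C j k != 0 -> f k = g k) ->
  \sum_k C j k * f k = \sum_k C j k * g k.
Proof.
move=> fg; apply: eq_bigr => k _.
by have [->|/fg ->//] := eqVneq (C j k) 0; rewrite !mul0r.
Qed.

Lemma linear_chart_op : linear_op chart_op.
Proof.
move=> a b u v w uvw j.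
have uvx : \forall x \ae mu, [set` J' j] x ->
    a * chart_op u j x + b * chart_op v j x = a * chart_sum u j x + b * chart_sum v j x.
  by apply: ae_imply2 (chart_opE u j) (chart_opE v j) => x + + Jx => -> // ->.
have wx : \forall x \ae mu, [set` J' j] x ->
    fun_of_L2 (chart_op w j) x = a * chart_sum u j x + b * chart_sum v j x.
  apply: ae_imply2 (ae_pullback j uvw) (chart_opE w j) => x uvwx wx Jx.
  rewrite wx// /chart_sum !mulr_sumr -big_split/=.
  under [RHS]eq_bigr do rewrite mulrCA [b * _]mulrCA -mulrDr.
  by apply: eq_sum_neq0 => k Cjk; rewrite uvwx.
by apply: ae_imply2 uvx wx => x h1 h2 Jx; rewrite h2// h1.
Qed.

Lemma Rintegral_chart_op u j h : square_integrable (J' j) h ->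
  \int[mu]_(x in [set` J' j]) (chart_op u j x * h x)
  = \sum_k C j k * \int[mu]_(x in [set` J' j])
      (u k (transition (c k) (c' j) x) * h x).
Proof.
move=> sh; transitivity (\int[mu]_(x in [set` J' j]) (\sum_k
    (C j k * u k (transition (c k) (c' j) x)) * h x)).
  apply: ae_eq_Rintegral.
  - by apply: measurable_funM; [exact: measurable_L2|exact: sh.1].
  - apply: measurable_sum => k; apply: measurable_funM; last exact: sh.1.
    exact: (square_integrable_term u j k).1.
  - by apply: ae_imply (chart_opE u j) => x uE /uE ->; rewrite mulr_suml.
rewrite Rintegral_sum; last first.
  by move=> k; apply: integrable_mul => //; exact: square_integrable_term.
apply: eq_bigr => k _.
have [->|Cjk] := eqVneq (C j k) 0.
  by rewrite mul0r; under eq_Rintegral do rewrite mul0r mul0r;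
    rewrite Rintegral_cst ?mul0r.
under eq_Rintegral do rewrite -mulrA.
rewrite RintegralZl//; apply: integrable_mul => //.
exact: (square_integrable_affine (adapted_transition Cjk) (square_integrable_L2 _)).
Qed.

Lemma inner_chart_opl u v : inner (chart_op u) v
  = \sum_j \sum_k C j k * \int[mu]_(x in [set` J' j])
      (u k (transition (c k) (c' j) x) * v j x).
Proof.
by apply: eq_bigr => j _; rewrite Rintegral_chart_op//; exact: square_integrable_L2.
Qed.

(** [sqr_sum_le] is applied pointwise; the substitution in each square then produces the inverse of
    the slope. *)
Lemma inner_chart_op_le (u : L2sum J) (j : 'I_q) :
  \int[mu]_(x in [set` J' j]) (chart_op u j x * chart_op u j x)
  <= 2 ^+ p * \sum_k C j k ^+ 2 / `|slope (transition (c k) (c' j))|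
                * \int[mu]_(x in [set` J k]) (u k x * u k x).
Proof.
pose F k x := C j k * u k (transition (c k) (c' j) x).
have sF k : square_integrable (J' j) (F k) by exact: square_integrable_term.
have sS : square_integrable (J' j) (chart_sum u j) by exact: square_integrable_sum.
have -> : \int[mu]_(x in [set` J' j]) (chart_op u j x * chart_op u j x)
    = \int[mu]_(x in [set` J' j]) (chart_sum u j x * chart_sum u j x).
  apply: ae_eq_Rintegral.
  - by apply: measurable_funM; exact: measurable_L2.
  - by apply: measurable_funM; exact: sS.1.
  - by apply: ae_imply (chart_opE u j) => x h /h ->.
have iF k : mu.-integrable [set` J' j] (fun x => (F k x * F k x)%:E) by exact: integrable_mul.
apply: (@le_trans _ _ (\int[mu]_(x in [set` J' j]) (2 ^+ p * \sum_k F k x * F k x))).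
  apply: le_Rintegral => [|||x _].
  - exact: mitv.
  - exact: integrable_mul.
  - exact: (integrableZl (mitv _) (2 ^+ p) (integrable_sum_ord iF)).
  - by rewrite -expr2; under [X in _ * X]eq_bigr do rewrite -expr2; exact: sqr_sum_le.
rewrite RintegralZl; last 2 first.
- exact: mitv.
- exact: integrable_sum_ord.
rewrite Rintegral_sum// ler_pM2l ?exprn_gt0//; apply: ler_sum => k _.
have [C0|Cjk] := eqVneq (C j k) 0.
  rewrite /F C0 expr0n/= !mul0r.
  by under eq_Rintegral do rewrite !mul0r; rewrite Rintegral_cst ?mul0r//; exact: mitv.
rewrite (Rintegral_affine_itv (adapted_transition Cjk)); last first.
  by apply: measurable_funM; exact: measurable_L2.
rewrite mulrA divfK ?normr_eq0 ?slope_neq0//.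
rewrite -RintegralZl; first by under eq_Rintegral do rewrite /F mulrACA -expr2.
  exact: mitv.
have suc := square_integrable_affine (adapted_transition Cjk) (square_integrable_L2 (u k)).
exact: (integrable_mul suc suc).
Qed.

Lemma bounded_chart_op : bounded_op chart_op.
Proof.
(* The coefficients of [inner_chart_op_le]. Each integral there is at most [inner u u], so their sum
   bounds the square of the operator norm. *)
pose m j k := 2 ^+ p * (C j k ^+ 2 / `|slope (transition (c k) (c' j))|).
exists (Num.sqrt (\sum_j \sum_k m j k)) => u.
have m0 j k : 0 <= m j k.
  by rewrite mulr_ge0 ?exprn_ge0// mulr_ge0 ?sqr_ge0// invr_ge0.
have I0 k : 0 <= \int[mu]_(x in [set` J k]) (u k x * u k x).
  by apply: Rintegral_ge0 => x _; rewrite -expr2 sqr_ge0.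
rewrite /norm -sqrtrM; last by apply: sumr_ge0 => j _; apply: sumr_ge0.
apply: ler_wsqrtr; rewrite mulr_suml; apply: ler_sum => j _.
apply: (le_trans (inner_chart_op_le u j)).
rewrite mulr_sumr mulr_suml; apply: ler_sum => k _.
rewrite mulrA ler_wpM2l//; first exact: m0.
by rewrite /inner (bigD1 k)//= lerDl; apply: sumr_ge0.
Qed.

End one_operator.
Arguments adapted {p q} J c J' c' C.
Arguments chart_op {p q} J c J' c' C u.

Section adapted_matrices.
Context (p q r : nat) (J : 'I_p -> interval R) (c : 'I_p -> affine_map R)
  (J' : 'I_q -> interval R) (c' : 'I_q -> affine_map R)
  (J'' : 'I_r -> interval R) (c'' : 'I_r -> affine_map R).

Lemma adapted_sym (C : 'M[R]_(q, p)) (D : 'M[R]_(p, q)) :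
  (forall k j, D k j != 0 -> C j k != 0) ->
  adapted J c J' c' C -> adapted J' c' J c D.
Proof. by move=> DC CJ k j /DC Cjk x; symmetry; exact: CJ. Qed.

Lemma adapted_sub (C D : 'M[R]_(q, p)) :
  (forall j k, D j k != 0 -> C j k != 0) ->
  adapted J c J' c' C -> adapted J c J' c' D.
Proof. by move=> DC CJ j k /DC Cjk; exact: CJ. Qed.

Lemma adapted_mul (C : 'M[R]_(q, p)) (D : 'M[R]_(r, q)) :
  adapted J c J' c' C -> adapted J' c' J'' c'' D ->
  adapted J c J'' c'' (D *m C).
Proof.
move=> CJ DJ l k; rewrite mxE => DClk x.
have [j] : exists j, D l j * C j k != 0.
  apply/existsP; apply: contraNT DClk; rewrite negb_exists => /forallP DC.
  by rewrite big1// => j _; apply/eqP; have := DC j; rewrite negbK.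
by rewrite mulf_eq0 negb_or => /andP[Dlj Cjk]; rewrite (CJ _ _ Cjk) (DJ _ _ Dlj).
Qed.

Lemma chart_op_comp (C : 'M[R]_(q, p)) (D : 'M[R]_(r, q)) :
  adapted J c J' c' C -> adapted J' c' J'' c'' D ->
  forall u, chart_op J' c' J'' c'' D (chart_op J c J' c' C u)
            = chart_op J c J'' c'' (D *m C) u.
Proof.
move=> CJ DJ u; apply/chart_opP => l; first exact: adapted_mul.
apply: ae_imply2 (chart_opE DJ (chart_op J c J' c' C u) l)
  (ae_pullback DJ l (fun j => chart_opE CJ u j)) => x Dx Cx Jx.
rewrite Dx// {1}/chart_sum (eq_sum_neq0 (Cx Jx)) /chart_sum.
under eq_bigr do rewrite mulr_sumr.
rewrite exchange_big/=; apply: eq_bigr => k _; rewrite mxE mulr_suml.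
(* The middle chart cancels between the two transitions, so the remaining one is independent of
   [j]. *)
by apply: eq_bigr => j _; rewrite mulrA !transitionE affine_invK.
Qed.

End adapted_matrices.

Lemma adapted1 (p : nat) (J : 'I_p -> interval R) c : adapted J c J c 1%:M.
Proof. by move=> i k; rewrite mxE; have [->//|_] := eqVneq i k; rewrite eqxx. Qed.

Lemma chart_op1 (p : nat) (J : 'I_p -> interval R) c u :
  chart_op J c J c 1%:M u = u.
Proof.
symmetry; apply/(chart_opP (@adapted1 p J c)) => j; apply: aeW => x _.
rewrite /chart_sum (bigD1 j)//= mxE eqxx mul1r transitionE affine_invKV big1 ?addr0//.
by move=> k kj; rewrite mxE eq_sym (negPf kj) mul0r.
Qed.

Section adjoint_chart_op.
Context (p q : nat) (J : 'I_p -> interval R) (c : 'I_p -> affine_map R)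
  (J' : 'I_q -> interval R) (c' : 'I_q -> affine_map R) (C : 'M[R]_(q, p)).
Hypothesis CJ : adapted J c J' c' C.

(** The transpose, weighted by the inverse Jacobian of the transition from [J' j] to [J k]. *)
Definition adjoint_mx : 'M[R]_(p, q) :=
  \matrix_(k, j) (C j k * (`|slope (c' j)| / `|slope (c k)|)).

Lemma adapted_adjoint_mx : adapted J' c' J c adjoint_mx.
Proof.
by apply: adapted_sym CJ => k j; rewrite mxE mulf_eq0 negb_or => /andP[].
Qed.

Lemma adjoint_chart_op :
  adjoint (chart_op J c J' c' C) (chart_op J' c' J c adjoint_mx).
Proof.
move=> u v; rewrite (inner_chart_opl CJ).
have -> : inner u (chart_op J' c' J c adjoint_mx v)
    = inner (chart_op J' c' J c adjoint_mx v) u.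
  by apply: eq_bigr => k _; under eq_Rintegral do rewrite mulrC.
rewrite (inner_chart_opl adapted_adjoint_mx) exchange_big/=.
apply: eq_bigr => k _; apply: eq_bigr => j _.
have [C0|Cjk] := eqVneq (C j k) 0; first by rewrite mxE C0 !mul0r.
rewrite mxE -mulrA; congr (_ * _).
rewrite (Rintegral_affine_itv (adapted_transition CJ Cjk)); last first.
  apply: measurable_funM; last exact: measurable_L2.
  by apply: measurableT_comp; [exact: measurable_L2|exact: measurable_affine].
rewrite /= normrM normfV mulrA.
rewrite (_ : _ / _ * _ = 1); last first.
  by field; rewrite !normr_eq0 !slope_neq0.
rewrite mul1r; apply: eq_Rintegral => x _.
by rewrite [in RHS]mulrC !transitionE affine_invK affine_invKV.
Qed.

End adjoint_chart_op.

Section derivative.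
Context (p q : nat) (J : 'I_p -> interval R) (c : 'I_p -> affine_map R)
  (J' : 'I_q -> interval R) (c' : 'I_q -> affine_map R) (C : 'M[R]_(q, p)).
Hypothesis CJ : adapted J c J' c' C.

(** The extra factor is the derivative of the transition, as in the chain rule. *)
Definition derivative_mx : 'M[R]_(q, p) :=
  \matrix_(j, k) (C j k * (slope (c k) / slope (c' j))).

Lemma adapted_derivative_mx : adapted J c J' c' derivative_mx.
Proof.
by apply: adapted_sub CJ => j k; rewrite mxE mulf_eq0 negb_or => /andP[].
Qed.

Lemma ddx_chart_op u g : ddx J (u, g) ->
  ddx J' (chart_op J c J' c' C u, chart_op J c J' c' derivative_mx g).
Proof.
move=> [_ ug].
suff dC j : weak_derivative (chart_op J c J' c' C u j)
    (chart_op J c J' c' derivative_mx g j).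
  by split=> // j; exists (chart_op J c J' c' derivative_mx g j).
move=> f tf.
have [sf sf' df] := test_functionP tf.
rewrite (Rintegral_chart_op CJ)// (Rintegral_chart_op adapted_derivative_mx)//.
rewrite -sumrN; apply: eq_bigr => k _.
have [C0|Cjk] := eqVneq (C j k) 0; first by rewrite mxE C0 !mul0r oppr0.
rewrite mxE -mulrA -mulrN; congr (_ * _).
set phi := transition (c k) (c' j).
have phiJ := adapted_transition CJ Cjk; rewrite -/phi in phiJ.
(* The test function is moved to [J k], where the hypothesis on [u k] applies. *)
pose h := f \o affine_inv phi.
have th : test_function (J k) h.
  by apply: test_function_affine tf => x; rewrite -phiJ affine_invKV.
have [sh sh' dh] := test_functionP th.
have fE : f = h \o phi by apply/funext => x; rewrite /h/= affine_invK.
have f'E x : derive1 f x = slope phi * derive1 h (phi x).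
  have := @derive1n_affine _ phi h 1 th.1; rewrite -fE => /(congr1 (@^~ x))/= ->.
  by rewrite expr1.
have suk v : square_integrable (J' j) (fun_of_L2 (v : L2 (J k)) \o phi).
  exact: (square_integrable_affine phiJ (square_integrable_L2 v)).
have := ug k h th.
rewrite (Rintegral_affine_itv phiJ); last first.
  by apply: measurable_funM; [exact: measurable_L2|exact: sh'.1].
rewrite (Rintegral_affine_itv phiJ); last first.
  by apply: measurable_funM; [exact: measurable_L2|exact: sh.1].
(* The Jacobian, an absolute value, cancels between the two sides; the signed slope in
   [derivative_mx] comes only from differentiating [f]. *)
rewrite -mulrN => /(mulfI _) ugh.
under eq_Rintegral do rewrite f'E mulrCA.
rewrite RintegralZl; last 2 first.
- exact: mitv.
- exact: (integrable_mul (suk (u k)) (square_integrable_affine phiJ sh')).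
rewrite ugh ?normr_eq0 ?slope_neq0//.
rewrite mulrN; congr (- (_ * _)); apply: eq_Rintegral => x _.
by rewrite /h/= affine_invK.
Qed.

End derivative.

End chart_operators.

Arguments adapted {R p q} J c J' c' C.
Arguments chart_op {R p q} J c J' c' C u.
Arguments chart_sum {R p q J} c c' C u j x.
Arguments adjoint_mx {R p q} c c' C.
Arguments derivative_mx {R p q} c c' C.

(** * Compatible matrices and endpoints of intervals *)

Section intervals.
Context (R : realType).
Local Notation mu := (@lebesgue_measure R).
Implicit Types J : interval R.

(** Serves as a label of the class of [J]: equality of interiors becomes equality of terms. *)
Definition open_itv J : interval R :=
  match J with
  | Interval (BSide _ a) (BSide _ b) => `]a, b[
  | Interval (BSide _ a) (BInfty _) => `]a, +oo[
  | Interval (BInfty _) (BSide _ b) => `]-oo, b[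
  | _ => `]-oo, +oo[
  end.

(** The two hypotheses on the intervals in a form suited to case analysis. As [BInfty true] is the
    bound at -oo and [BInfty false] the one at +oo, the conditions on [s] exclude infinite bounds on
    the wrong side. *)
Definition nondegenerate J : bool :=
  match J with
  | Interval (BSide _ a) (BSide _ b) => a < b
  | Interval (BSide _ _) (BInfty s) => ~~ s
  | Interval (BInfty s) (BSide _ _) => s
  | _ => false
  end.

Lemma nondegenerateP J : [set` J]° !=set0 -> ~` [set` J] !=set0 -> nondegenerate J.
Proof.
move=> [x Jx] [y /= Jy].
have := interior_subset Jx; move: Jx Jy.
case: J => [[s a|[|]] [t b|[|]]] //=; rewrite ?in_itv//= ?andbF//.
by rewrite interior_itv_bnd/= in_itv/= => /andP[ax xb] _ _; exact: lt_trans xb.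
Qed.

Lemma interior_open_itv J : nondegenerate J -> [set` J]° = [set` open_itv J].
Proof.
case: J => [[s a|[|]] [t b|[|]]] //= _.
- by rewrite interior_itv_bnd.
- by rewrite interior_itv_bndy.
- by rewrite interior_itv_Nybnd.
Qed.

(** Boundedness from above and below tells which endpoints are finite, and [inf] and [sup] recover
    them. *)
Lemma open_itv_inj J J' : nondegenerate J -> nondegenerate J' ->
  [set` J]° = [set` J']° -> open_itv J = open_itv J'.
Proof.
move=> J0 J0'; rewrite !interior_open_itv// => JJ'.
have := congr1 (@inf R) JJ'; have := congr1 (@sup R) JJ'.
have := congr1 (@has_ubound _ R) JJ'; have := congr1 (@has_lbound _ R) JJ'.
have eqF (P Q : Prop) : P -> ~ Q -> P = Q -> False by move=> p q pq; apply: q; rewrite -pq.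
have Nub (a : R) : ~ has_ubound [set` `]a, +oo[] by apply: hasNubound_itv; rewrite lt_eqF.
have Nlb (a : R) : ~ has_lbound [set` `]-oo, a[] by apply: hasNlbound_itv; rewrite gt_eqF.
case: J J' J0 J0' {JJ'} => [[s a|[|]] [t b|[|]]] [[s' a'|[|]] [t' b'|[|]]] //= ab a'b' lb ub.
- by rewrite !inf_itv// !sup_itv// => -> ->.
- by have := eqF _ _ (has_ubound_itv _ _ _) (Nub _) ub.
- by have := eqF _ _ (has_lbound_itv _ _ _) (Nlb _) lb.
- by have := eqF _ _ (has_ubound_itv _ _ _) (Nub _) (esym ub).
- by rewrite !inf_itv// => _ ->.
- by have := eqF _ _ (has_lbound_itv _ _ _) (Nlb _) lb.
- by have := eqF _ _ (has_lbound_itv _ _ _) (Nlb _) (esym lb).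
- by have := eqF _ _ (has_lbound_itv _ _ _) (Nlb _) (esym lb).
- by rewrite !sup_itv// => ->.
Qed.

Lemma ae_itv_nonempty (a b : R) (P : R -> Prop) : a < b ->
  (\forall x \ae mu, x \in `]a, b[ -> P x) -> exists2 x, x \in `]a, b[ & P x.
Proof.
move=> ab aP; apply: contrapT => nP.
have : mu.-negligible [set` `]a, b[].
  apply: negligibleS aP => x xab /= /(_ xab) Px; apply: nP; by exists x.
have mab : @measurable _ (measurableTypeR R) [set` `]a, b[] by exact: measurable_itv.
move=> nab; have : mu [set` `]a, b[] = 0%E by exact: (negligibleP mu mab).1.
rewrite lebesgue_measure_itv/= lte_fin ab.
by move/eqP; rewrite -EFinD eqe subr_eq0 gt_eqF.
Qed.

(** There are points of [J'] close to [x] on both sides, and [J'] contains everything between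
    them. *)
Lemma ae_subset_interior J J' :
  (forall x, [set` J]° x -> exists2 e : R, 0 < e &
     \forall y \ae mu, y \in `]x - e, x + e[ -> [set` J'] y) ->
  [set` J]° `<=` [set` J']°.
Proof.
move=> JJ' x /JJ'[e e0 aJ'].
have [y + J'y] : exists2 y, y \in `]x - e, x[ & [set` J'] y.
  apply: ae_itv_nonempty; first by rewrite gtrBl.
  apply: ae_imply aJ' => y + yx; apply; move: yx; rewrite !in_itv/= => /andP[-> yx]/=.
  by rewrite (lt_trans yx)// ltrDl.
have [z + J'z] : exists2 z, z \in `]x, x + e[ & [set` J'] z.
  apply: ae_itv_nonempty; first by rewrite ltrDl.
  apply: ae_imply aJ' => z + xz; apply; move: xz; rewrite !in_itv/= => /andP[xz ->]; rewrite andbT.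
  by rewrite (lt_trans _ xz)// gtrBl.
rewrite !in_itv/= => /andP[xz _] /andP[_ yx].
have yz : [set` `]y, z[] `<=` [set` J'].
  move=> w /=; rewrite in_itv/= => /andP[yw wz].
  by apply: (@interval_is_interval _ J' y z) => //; rewrite !ltW.
by apply: (interiorS yz); rewrite interior_itv_bnd /= in_itv/= yx xz.
Qed.

Lemma square_integrable_indic J (a b : R) : square_integrable J (\1_[set` `]a, b[]).
Proof.
split; first by apply: measurable_indic; exact: measurable_itv.
apply: (integrableS measurableT _ (@subsetT _ _)); first exact: measurable_itv.
have := @integrable_indic_itv R a b false true; apply: eq_integrable => // x _.
by rewrite /= indicE; case: (_ \in _); rewrite ?expr1n ?expr0n.
Qed.

(* Compatibility is tested on the indicator function of a small interval around
   a point of J k. *)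
Lemma compatible_subset (p q : nat) (J : 'I_p -> interval R)
    (J' : 'I_q -> interval R) (P : 'M[R]_(q, p)) :
  compatible J J' P -> forall j k, P j k != 0 -> [set` J k]° `<=` [set` J' j]°.
Proof.
move=> PJ j k Pjk; apply: ae_subset_interior => x Jx.
have [e /= e0 exJ] : exists2 e : R, 0 < e & [set` `]x - e, x + e[] `<=` [set` J k].
  have : nbhs x [set` J k] by exact: Jx.
  move=> /nbhs_ballP[e /= e0 eJ]; exists e => // y; rewrite /= in_itv/= => xy.
  by apply: eJ; rewrite /ball/= distrC ltr_distl.
exists e => //.
pose f l : R -> R := if l == k then \1_[set` `](x - e), (x + e)[] else fun=> 0.
have sf l : square_integrable (J l) (f l).
  by rewrite /f; case: ifP => _; [exact: square_integrable_indic|exact: square_integrable0].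
have [v /(_ j) vE] := PJ (fun l => to_L2 (J l) (f l)).
have uE := ae_forall (fun l => to_L2E (sf l)).
apply: ae_imply2 vE uE => y + uE yx; move=> /(_ I)/=.
(* For [y] outside [J' j] the left-hand side would be 0, while on the right only the [k]-th term
   survives and equals [P j k]. *)
apply: contraPP => nJ'y; rewrite patchE memNset//.
rewrite (bigD1 k)//= patchE mem_set; last exact: exJ.
rewrite uE; last exact: exJ.
rewrite {1}/f eqxx indicE mem_set//= mulr1 big1 ?addr0.
  by move=> /esym/eqP; rewrite (negPf Pjk).
move=> l lk; rewrite patchE; case: ifPn => [|_]; last by rewrite mulr0.
by rewrite inE => Jly; rewrite uE// /f (negPf lk) mulr0.
Qed.

End intervals.

(** * Congruence of block matrices *)

Section congruence.
Context (R : rcfType) (n : nat) (T : Type) (f : 'I_n -> T).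
Implicit Types P Q S : 'M[R]_n.

Definition blockwise P : Prop := forall j k, P j k != 0 -> f j = f k.

Lemma blockwise1 : blockwise 1%:M.
Proof. by move=> j k; rewrite mxE; have [->//|_] := eqVneq j k; rewrite eqxx. Qed.

Lemma blockwise_tr P : blockwise P -> blockwise P^T.
Proof. by move=> bP j k; rewrite mxE => /bP. Qed.

Lemma sum_neq0 (I : finType) (F : I -> R) : \sum_i F i != 0 -> exists i, F i != 0.
Proof.
move=> F0; apply/existsP; apply: contraNT F0; rewrite negb_exists => /forallP F0.
by rewrite big1// => i _; apply/eqP; rewrite -[_ == _]negbK F0.
Qed.

Lemma blockwise_mul P Q : blockwise P -> blockwise Q -> blockwise (P *m Q).
Proof.
move=> bP bQ j k; rewrite mxE => /sum_neq0[l].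
by rewrite mulf_eq0 negb_or => /andP[/bP -> /bQ].
Qed.

(** The transforming matrix itself has to respect the blocks, because its rows become the rows of
    the operator. *)
Definition congruent P Q : Prop :=
  exists S, [/\ S \in unitmx, blockwise S & Q = S *m P *m S^T].

Lemma congruent_refl P : congruent P P.
Proof.
by exists 1%:M; split; [exact: unitmx1|exact: blockwise1|rewrite trmx1 mulmx1 mul1mx].
Qed.

Lemma congruent_trans P Q S : congruent P Q -> congruent Q S -> congruent P S.
Proof.
move=> [A [uA bA ->]] [B [uB bB ->]]; exists (B *m A); split.
- by rewrite unitmx_mul uB.
- exact: blockwise_mul.
- by rewrite trmx_mul !mulmxA.
Qed.

(** Adds [w a] times row [j] to each row [a], then does the same with columns: S P S^T for S = 1 + w
    e_j^T. *)
Definition transvected P (w : 'I_n -> R) j : 'M[R]_n :=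
  \matrix_(a, b) (P a b + w a * P j b + w b * P a j + w a * w b * P j j).

Lemma congruent_transvected P (w : 'I_n -> R) j : w j = 0 ->
  (forall a, w a != 0 -> f a = f j) -> congruent P (transvected P w j).
Proof.
move=> wj bw.
pose W : 'cV[R]_n := \col_a w a.
pose d : 'rV[R]_n := delta_mx 0 j.
exists (1%:M + W *m d); split.
(* Because [w j = 0], the product [d *m W] vanishes and [W *m d] squares to zero, which gives the
   inverse. *)
- suff /mulmx1_unit[//] : (1%:M + W *m d) *m (1%:M - W *m d) = 1%:M.
  rewrite mulmxDl mul1mx mulmxBr mulmx1 mulmxA -(mulmxA W d W).
  have -> : d *m W = 0.
    by apply/matrixP => a b; rewrite -rowE !mxE wj.
  by rewrite mulmx0 mul0mx subr0 subrK.
- move=> a b; rewrite !mxE big_ord1 !mxE eqxx/=.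
  have [->//|ab] := eqVneq a b; rewrite add0r.
  have [->|bj] := eqVneq b j; last by rewrite mulr0 eqxx.
  by rewrite mulr1 => /bw.
- have SE (M : 'M[R]_n) a b : ((1%:M + W *m d) *m M) a b = M a b + w a * M j b.
    by rewrite mulmxDl mul1mx -mulmxA -rowE !mxE big_ord1 !mxE.
  rewrite -[RHS]trmxK trmx_mul trmxK; apply/matrixP => a b.
  by rewrite [in LHS]mxE [RHS]mxE SE ![_^T _ _]mxE !SE mulrDr !addrA mulrCA mulrA.
Qed.

(** For symmetric [P] this says that the j-th variable is split off from the quadratic form. *)
Definition isolated P j : bool := [forall k, (k != j) ==> (P j k == 0)].

Lemma isolatedP P j : reflect (forall k, k != j -> P j k = 0) (isolated P j).
Proof.
by apply: (iffP forallP) => h k; [move=> kj; apply/eqP; have /implyP := h k; apply|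
  apply/implyP => kj; apply/eqP; exact: h].
Qed.

Lemma tr_congruent P Q : P = P^T -> congruent P Q -> Q = Q^T.
Proof. by move=> symP [S [_ _ ->]]; rewrite !trmx_mul trmxK -symP mulmxA. Qed.

Lemma blockwise_congruent P Q : blockwise P -> congruent P Q -> blockwise Q.
Proof.
move=> bP [S [_ bS ->]]; apply: blockwise_mul; last exact: blockwise_tr.
exact: blockwise_mul.
Qed.

(* If P_jj = P_kk = 0, adding the k-th row and column to the j-th ones puts
   2 P_jk at the place (j, j). *)
Lemma congruent_pivot P j : P = P^T -> blockwise P -> ~~ isolated P j ->
  exists Q k, [/\ congruent P Q, ~~ isolated P k, Q k k != 0 &
    forall i, isolated P i -> isolated Q i].
Proof.
move=> symP bP Pj; have sym a b : P a b = P b a by rewrite [in LHS]symP mxE.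
have [Pjj|Pjj] := eqVneq (P j j) 0; last by exists P, j; split => //; exact: congruent_refl.
have [k kj Pjk] : exists2 k, k != j & P j k != 0.
  move: Pj; rewrite /isolated negb_forall => /existsP[k].
  by rewrite negb_imply => /andP[kj Pjk]; exists k.
have Pk : ~~ isolated P k.
  by apply: contra Pjk => /isolatedP Pk; rewrite sym Pk// eq_sym.
have [Pkk|Pkk] := eqVneq (P k k) 0; last by exists P, k; split => //; exact: congruent_refl.
pose w i : R := (i == j)%:R.
exists (transvected P w k), j; split => //.
- apply: congruent_transvected; first by rewrite /w (negPf kj).
  by move=> a; rewrite /w; have [-> _|_] := eqVneq a j; [exact: bP|by rewrite mulr0n eqxx].
- rewrite mxE /w eqxx Pjj Pkk (sym k j) !mul1r add0r addr0 -mulr2n mulrn_eq0 negb_or.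
  exact: Pjk.
(* An isolated [i] differs from [j] and [k], so [w i], [P i k] and [P i l] all vanish. *)
- move=> i /[dup] iP /isolatedP Pi; apply/isolatedP => l li.
  have ij : i != j by apply: contraNneq Pj => <-.
  have ki : k != i by apply: contraNneq Pk => ->.
  by rewrite mxE /w (negPf ij) (Pi l)// (Pi k)// !mul0r mulr0 !addr0.
Qed.

Lemma congruent_isolate P j : P = P^T -> blockwise P -> P j j != 0 ->
  exists Q, [/\ congruent P Q, isolated Q j &
    forall i, isolated P i -> isolated Q i].
Proof.
move=> symP bP Pjj; have sym a b : P a b = P b a by rewrite [in LHS]symP mxE.
(* Elimination with pivot [P j j]. An isolated [i] other than [j] has [P i j = 0], so its row is not
   touched. *)
pose w i := if i == j then 0 else - (P i j / P j j).
exists (transvected P w j); split.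
- apply: congruent_transvected; first by rewrite /w eqxx.
  move=> a; rewrite /w; have [_|_] := eqVneq a j; first by rewrite eqxx.
  by rewrite oppr_eq0 mulf_eq0 negb_or => /andP[/bP].
- apply/isolatedP => k kj; rewrite mxE /w eqxx (negPf kj) !mul0r !addr0.
  by rewrite mulNr divfK// (sym k) subrr.
- move=> i /isolatedP Pi; apply/isolatedP => l li; rewrite mxE (Pi l li) add0r.
  have [ij|ij] := eqVneq i j.
    by rewrite /w ij eqxx -ij (negPf li) !mul0r !addr0 add0r mulNr divfK ?ij// -ij sym Pi// oppr0.
  rewrite /w (negPf ij) (Pi j) 1?eq_sym//.
  by rewrite !mul0r oppr0 !mul0r mulr0 !addr0.
Qed.

Lemma congruent_diagonal P : P = P^T -> blockwise P ->
  exists Q, congruent P Q /\ forall j, isolated Q j.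
Proof.
have [m] := ubnP #|[set j | ~~ isolated P j]%SET|.
elim: m P => // m IHm P Pm symP bP.
have [Pi|] := boolP [forall j, isolated P j].
  by exists P; split; [exact: congruent_refl|exact/forallP].
rewrite negb_forall => /existsP[j Pj].
have [Q [k [PQ Pk Qkk iQ]]] := congruent_pivot symP bP Pj.
have [S [QS Sk iS]] := congruent_isolate (tr_congruent symP PQ) (blockwise_congruent bP PQ) Qkk.
have PS := congruent_trans PQ QS.
have [|D [SD iD]] := IHm S _ (tr_congruent symP PS) (blockwise_congruent bP PS).
  (* The number of non-isolated indices drops: isolated ones stay so, and [k], which may differ from
     the chosen [j], becomes isolated. *)
  rewrite -ltnS (leq_trans _ Pm)// ltnS; apply: proper_card; apply/properP; split.
    by apply/fintype.subsetP => i; rewrite !inE; apply: contra => /iQ/iS.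
  by exists k; rewrite !inE ?Pk// Sk.
by exists D; split => //; exact: congruent_trans SD.
Qed.

Lemma blockwise_signature P : P = P^T -> P \in unitmx -> blockwise P ->
  exists (B : 'M[R]_n) (s : 'I_n -> bool), blockwise B /\
    B *m P *m B^T = \matrix_(j, k) ((j == k)%:R * (-1) ^+ s j).
Proof.
move=> symP uP bP; have [D [[S [uS bS DE]] iD]] := congruent_diagonal symP bP.
have uD : D \in unitmx by rewrite DE !unitmx_mul uS uP unitmx_tr.
have D0 j : D j j != 0.
  apply/eqP => Djj; have /(congr1 (fun M : 'M[R]_n => M j j)) := mulmxV uD.
  rewrite !mxE eqxx big1 => [/eqP|k _]; first by rewrite eq_sym oner_eq0.
  have [->|kj] := eqVneq k j; first by rewrite Djj mul0r.
  by have /isolatedP -> := iD j; rewrite ?mul0r.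
(* Scaling by [e] on both sides divides [D j j] by its absolute value and leaves its sign. *)
pose e j := (Num.sqrt `|D j j|)^-1.
have e0 j : e j ^+ 2 = `|D j j|^-1 by rewrite exprVn sqr_sqrtr.
pose E : 'M[R]_n := diag_mx (\row_j e j).
exists (E *m S), (fun j => D j j < 0); split.
  move=> j k; rewrite mul_diag_mx !mxE mulf_eq0 negb_or => /andP[_]; exact: bS.
rewrite trmx_mul tr_diag_mx !mulmxA -[E *m S *m P]mulmxA -[E *m _ *m (S^T)]mulmxA -DE.
apply/matrixP => j k; rewrite mul_mx_diag mul_diag_mx !mxE.
have [<-|jk] := eqVneq j k; last first.
  have /isolatedP/(_ k) -> := iD j; last by rewrite eq_sym.
  by rewrite mulr0 !mul0r.
rewrite mul1r mulrC mulrA -expr2 e0.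
rewrite [X in _ * X](numEsg (D j j)) sgr_def D0 mulr1n.
by rewrite mulrCA mulVf ?normr_eq0// mulr1.
Qed.

End congruence.

(** * The operators of the factorization in charts *)

Section charts.
Context (R : realType).
Implicit Types J : interval R.

Lemma sign_slope_neq0 (s : bool) : (-1) ^+ s != 0 :> R.
Proof. by rewrite signr_eq0. Qed.

Definition sign_chart (s : bool) : affine_map R := AffineMap 0 (sign_slope_neq0 s).

Lemma sign_chartE s x : sign_chart s x = if s then - x else x.
Proof. by case: s; rewrite /affine_fun/= ?expr1 ?mulN1r ?expr0 ?mul1r addr0. Qed.

Lemma sign_chart_inv s x : affine_inv (sign_chart s) x = if s then - x else x.
Proof.
case: s; rewrite /affine_fun/= mulr0 oppr0 addr0.
  by rewrite expr1 invrN1 mulN1r.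
by rewrite expr0 invr1 mul1r.
Qed.

(* The value 1 for b <= a only serves to make every slope positive. *)
Definition Phi_slope J : R :=
  if J is Interval (BSide _ a) (BSide _ b) then
    if a < b then b - a else 1
  else 1.

Lemma Phi_slope_gt0 J : 0 < Phi_slope J.
Proof.
case: J => [[s a|s] [t b|t]] //=; rewrite ?ltr01//.
by case: ifPn => [ab|_]; rewrite ?ltr01// subr_gt0.
Qed.

(** The value of [Phi_map J] at 0. *)
Definition Phi_shift J : R :=
  match J with
  | Interval (BSide _ a) (BSide _ b) => (a + b) / 2
  | Interval (BSide _ a) (BInfty _) => a + 2^-1
  | Interval (BInfty _) (BSide _ b) => b - 2^-1
  | _ => 0
  end.

Definition Phi_chart J : affine_map R :=
  AffineMap (Phi_shift J) (lt0r_neq0 (Phi_slope_gt0 J)).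

Lemma Phi_chartE J x : nondegenerate J -> Phi_chart J x = Phi_map J x.
Proof.
case: J => [[s a|[|]] [t b|[|]]] //=; rewrite /affine_fun/=.
- by move=> ->/=; field.
- by rewrite mul1r addrA.
- by rewrite mul1r addrA.
Qed.

Lemma Phi_chart_open_itv J : Phi_chart (open_itv J) = Phi_chart J.
Proof. by apply: affine_map_eq; case: J => [[s a|[|]] [t b|[|]]]. Qed.

Lemma Phi_factor_neq0 J : nondegenerate J -> Phi_factor J != 0.
Proof.
case: J => [[s a|[|]] [t b|[|]]] //=; rewrite ?oner_neq0// => ab.
by rewrite gt_eqF// sqrtr_gt0 subr_gt0.
Qed.

Definition std_shape J : interval R :=
  match J with
  | Interval (BSide _ _) (BSide _ _) => `](- 2^-1), 2^-1[
  | Interval (BSide _ _) _ => `](- 2^-1), +oo[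
  | _ => `]-oo, 2^-1[
  end.

Lemma std_shape_open_itv J J' : nondegenerate J -> nondegenerate J' ->
  open_itv J = open_itv J' -> std_shape J = std_shape J'.
Proof. by case: J J' => [[s a|[|]] [t b|[|]]] [[s' a'|[|]] [t' b'|[|]]]. Qed.

Lemma interior_std_shape J : [set` std_shape J]° = [set` std_shape J].
Proof.
by case: J => [[s a|s] [t b|t]]; rewrite ?interior_itv_bnd ?interior_itv_bndy ?interior_itv_Nybnd.
Qed.

Lemma Phi_chart_interior J : nondegenerate J ->
  forall x, [set` J]° (Phi_chart J x) <-> [set` std_shape J]° x.
Proof.
move=> J0 x; rewrite interior_open_itv// interior_std_shape Phi_chartE//.
case: J J0 => [[s a|[|]] [t b|[|]]] //= ab; rewrite !in_itv/= ?andbT.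
- suff -> : (a < - (x - 2^-1) * a + (x + 2^-1) * b < b) = (- 2^-1 < x < 2^-1) by [].
  rewrite -[a < _]subr_gt0 -[_ < b]subr_gt0.
  have -> : - (x - 2^-1) * a + (x + 2^-1) * b - a = (b - a) * (x - - 2^-1) by field.
  have -> : b - (- (x - 2^-1) * a + (x + 2^-1) * b) = (b - a) * (2^-1 - x) by field.
  by rewrite !pmulr_rgt0 ?subr_gt0.
- suff -> : (a < x + a + 2^-1) = (- 2^-1 < x) by [].
  by apply/idP/idP => h; lra.
- suff -> : (x + b - 2^-1 < b) = (x < 2^-1) by [].
  by apply/idP/idP => h; lra.
Qed.

Lemma interior_flip_itv s J x :
  [set` flip_itv s (std_shape J)]° (sign_chart s x) <-> [set` std_shape J]° x.
Proof.
rewrite sign_chartE interior_std_shape; case: s => /=; last by rewrite interior_std_shape.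
by case: J => [[s a|s] [t b|t]] /=;
  rewrite ?interior_itv_bnd ?interior_itv_bndy ?interior_itv_Nybnd /= !in_itv/= ?andbT;
  rewrite ?opprK ?ltrN2 // 1?andbC ltrNl.
Qed.

End charts.

Section block_index.
Context (N : nat) (A B C : {set 'I_N}).

(** [Psi_idx] for arbitrary index sets; it also orders the target, whose half-lines are sorted after
    reflection. *)
Definition block_idx (j : 'I_(#|A| + #|B| + #|C|)) : 'I_N :=
  match fintype.split j with
  | inl i => match fintype.split i with
             | inl i' => enum_val i'
             | inr i' => enum_val i'
             end
  | inr i => enum_val i
  end.

Hypothesis partABC : forall k, ((k \in A) + (k \in B) + (k \in C) = 1)%N.

(** Summing [partABC] over [k] counts every index once. *)
Lemma card_blocks : (#|A| + #|B| + #|C|)%N = N.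
Proof.
rewrite -!sum1_card !(big_mkcond (fun i => i \in _))/= -!big_split/=.
rewrite -[RHS]card_ord -sum1_card; apply: eq_bigr => k _.
by have := partABC k; do 3 case: (_ \in _).
Qed.

Lemma block_idx_inj : injective block_idx.
Proof.
have dAB k : k \in A -> k \in B -> False by move=> kA kB; have := partABC k; rewrite kA kB.
have dAC k : k \in A -> k \in C -> False.
  by move=> kA kC; have := partABC k; rewrite kA kC; case: (_ \in _).
have dBC k : k \in B -> k \in C -> False.
  by move=> kB kC; have := partABC k; rewrite kB kC; case: (_ \in _).
move=> i j; rewrite /block_idx.
case: (split_ordP i) => {}i ->; first case: (split_ordP i) => {}i ->;
  case: (split_ordP j) => {}j ->; try (case: (split_ordP j) => {}j ->);
  move=> ij; have := enum_valP i; have := enum_valP j; rewrite ij => jX iX.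
all: solve [by rewrite (enum_val_inj ij)
  | by case: (dAB _ iX jX) | by case: (dAB _ jX iX) | by case: (dAC _ iX jX)
  | by case: (dAC _ jX iX) | by case: (dBC _ iX jX) | by case: (dBC _ jX iX)].
Qed.

Lemma block_idx_bij : bijective block_idx.
Proof. by apply: inj_card_bij block_idx_inj _; rewrite !card_ord card_blocks. Qed.

End block_index.

Section operators_in_charts.
Context (R : realType).
Local Notation mu := (@lebesgue_measure R).

(** [mx_op] adds functions at the same point, while [chart_op] changes variables. If coordinates
    linked by a nonzero entry share a chart, the transitions involved are the identity and the
    supports agree almost everywhere. *)
Lemma mx_op_chart (p q : nat) (J : 'I_p -> interval R) c
    (J' : 'I_q -> interval R) c' (P : 'M[R]_(q, p)) :
  adapted J c J' c' P -> (forall j k, P j k != 0 -> c k =1 c' j) ->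
  mx_op J J' P = op_graph (chart_op J c J' c' P).
Proof.
move=> PJ cc'; have cK j k : P j k != 0 -> forall x, transition (c k) (c' j) x = x.
  by move=> Pjk x; rewrite transitionE (cc' _ _ Pjk) affine_invKV.
have ae_supp j : \forall x \ae mu, forall k, P j k != 0 -> [set` J k] x <-> [set` J' j] x.
  apply: ae_forall => k; have [_|Pjk] := eqVneq (P j k) 0; first exact: aeW.
  by apply: ae_imply (ae_matching_itv (adapted_transition PJ Pjk)) => x; rewrite cK.
have sumE u j x : (forall k, P j k != 0 -> [set` J k] x <-> [set` J' j] x) ->
    \sum_k P j k * (fun_of_L2 (u k : L2 (J k)) \_ [set` J k]) x
    = if x \in [set` J' j] then chart_sum c c' P u j x else 0.
  move=> suppx; case: ifPn => [|/negP]; rewrite inE => Jx.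
    by apply: eq_sum_neq0 => k Pjk; rewrite patchE mem_set ?cK//; exact/suppx.
  rewrite big1// => k _; have [->|Pjk] := eqVneq (P j k) 0; first by rewrite mul0r.
  by rewrite patchE memNset ?mulr0// => /(suppx _ Pjk).
apply/seteqP; split=> -[u v] /=.
  move=> uv; apply/(chart_opP PJ) => j.
  apply: ae_imply2 (uv j) (ae_supp j) => x /(_ I) vx suppx Jx.
  by move: vx; rewrite sumE// patchE mem_set.
rewrite /op_graph/= => -> j; apply: ae_imply2 (chart_opE PJ u j) (ae_supp j) => x vx suppx _.
by rewrite sumE// patchE; case: ifPn => // /[!inE] /vx.
Qed.

Lemma compatible_chart (p q : nat) (J : 'I_p -> interval R) c
    (J' : 'I_q -> interval R) c' (P : 'M[R]_(q, p)) :
  adapted J c J' c' P -> (forall j k, P j k != 0 -> c k =1 c' j) ->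
  compatible J J' P.
Proof.
by move=> PJ cc' u; exists (chart_op J c J' c' P u); rewrite (mx_op_chart PJ cc').
Qed.

Lemma op_graph_comp (X Y Z : Type) (g : Y -> Z) (f : X -> Y) :
  (op_graph g \; op_graph f)%relation = op_graph (g \o f).
Proof.
rewrite /op_graph; apply/seteqP; split=> -[x z] /=; first by move=> [y -> ->].
by move=> ->; exists (f x).
Qed.

Lemma reflection_op_chart (p : nat) (J : 'I_p -> interval R) (s : 'I_p -> bool) :
  adapted J (fun=> sign_chart R false) (fun k => flip_itv (s k) (J k))
    (fun k => sign_chart R (s k)) 1%:M ->
  reflection_op J s = op_graph (chart_op J (fun=> sign_chart R false)
    (fun k => flip_itv (s k) (J k)) (fun k => sign_chart R (s k)) 1%:M).
Proof.
move=> sJ; have sumE u k x :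
    chart_sum (fun=> sign_chart R false) (fun k => sign_chart R (s k)) 1%:M u k x
    = fun_of_L2 (u k : L2 (J k)) (if s k then - x else x).
  rewrite /chart_sum (bigD1 k)//= mxE eqxx mul1r big1 ?addr0 => [|l lk]; last first.
    by rewrite mxE eq_sym (negPf lk) mul0r.
  by rewrite transitionE sign_chartE sign_chart_inv.
apply/seteqP; split=> -[u v] /=.
  move=> uv; apply/(chart_opP sJ) => k.
  by apply: ae_imply (uv k) => x vx Jx; rewrite sumE; exact: vx.
rewrite /op_graph/= => -> k.
by apply: ae_imply (chart_opE sJ u k) => x vx Jx; rewrite -sumE; exact: vx.
Qed.

Section Psi_chart.
Context (N : nat) (I : 'I_N -> interval R).
Hypothesis I0 : forall k, nondegenerate (I k).

Lemma Psi_itvE j : Psi_itv I j = std_shape (I (Psi_idx j)).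
Proof.
rewrite /Psi_itv /std_itv /Psi_idx; case: fintype.split => [i|i]; first case: fintype.split => {}i.
- have := enum_valP i; rewrite inE; have := I0 (enum_val i).
  by case: (I _) => [[? ?|[|]] [? ?|[|]]].
- have := enum_valP i; rewrite inE; have := I0 (enum_val i).
  by case: (I _) => [[? ?|[|]] [? ?|[|]]].
- have := enum_valP i; rewrite inE; have := I0 (enum_val i).
  by case: (I _) => [[? ?|[|]] [? ?|[|]]].
Qed.

Definition Psi_mx : 'M[R]_(#|bnd_idx I| + #|up_idx I| + #|low_idx I|, N) :=
  \matrix_(j, k) ((k == Psi_idx j)%:R * Phi_factor (I k)).

Lemma adapted_Psi : adapted I (fun k => Phi_chart (I k)) (Psi_itv I)
  (fun=> sign_chart R false) Psi_mx.
Proof.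
move=> j k; rewrite mxE; have [->|_] := eqVneq k (Psi_idx j); last by rewrite mul0r eqxx.
by move=> _ x; rewrite Psi_itvE Phi_chart_interior// sign_chartE.
Qed.

Lemma Psi_chart : Psi I = op_graph (chart_op I (fun k => Phi_chart (I k))
  (Psi_itv I) (fun=> sign_chart R false) Psi_mx).
Proof.
have sumE u j x :
    chart_sum (fun k => Phi_chart (I k)) (fun=> sign_chart R false) Psi_mx u j x
    = Phi_factor (I (Psi_idx j))
      * fun_of_L2 (u (Psi_idx j)) (Phi_map (I (Psi_idx j)) x).
  rewrite /chart_sum (bigD1 (Psi_idx j))//= mxE eqxx mul1r big1 ?addr0 => [|l lj]; last first.
    by rewrite mxE (negPf lj) !mul0r.
  by rewrite transitionE Phi_chartE// sign_chart_inv.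
apply/seteqP; split=> -[u v] /=.
  move=> uv; apply/(chart_opP adapted_Psi) => j.
  by apply: ae_imply (uv j) => x vx Jx; rewrite sumE; exact: vx.
rewrite /op_graph/= => -> j.
by apply: ae_imply (chart_opE adapted_Psi u j) => x vx Jx; rewrite -sumE; exact: vx.
Qed.

End Psi_chart.

End operators_in_charts.

(** * Reduction to the normal form *)

(** The block sizes of the target add up to [N] only propositionally, so its matrices do not have a
    square type. *)
Lemma mulmx1C_eq_dim (R : comNzRingType) (m n : nat) (A : 'M[R]_(m, n))
    (B : 'M[R]_(n, m)) :
  m = n -> A *m B = 1%:M -> B *m A = 1%:M.
Proof. by move=> mn; subst m; exact: mulmx1C. Qed.

Lemma chart_opK (R : realType) (p q : nat)
    (J : 'I_p -> interval R) c (J' : 'I_q -> interval R) c'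
    (C : 'M[R]_(q, p)) (D : 'M[R]_(p, q)) :
  adapted J c J' c' C -> adapted J' c' J c D -> D *m C = 1%:M ->
  cancel (chart_op J c J' c' C) (chart_op J' c' J c D).
Proof. by move=> CJ DJ DC u; rewrite (chart_op_comp CJ DJ) DC chart_op1. Qed.

(* If X = C P represents V P and Y represents d V^*, in the sense that
   d V^* extends Y d, then X Y = 1 gives d <= V P d V^*. The other inclusion
   follows from the same argument for the inverse Z of the matrix of V^*. *)
Lemma conjugated_derivative (R : realType) (p q : nat)
    (J : 'I_p -> interval R) c (J' : 'I_q -> interval R) c'
    (P : 'M[R]_p) (C : 'M[R]_(q, p)) :
  adapted J c J' c' C -> adapted J c J c P ->
  (forall j k, P j k != 0 -> c j =1 c k) ->
  (C *m P) *m derivative_mx c' c (adjoint_mx c c' C) = 1%:M ->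
  (op_graph (chart_op J c J' c' C) \; (mx_op J J P \;
    (ddx J \; op_graph (chart_op J' c' J c (adjoint_mx c c' C)))))%relation
  = ddx J'.
Proof.
move=> CJ PJ cP XY1.
set D := adjoint_mx c c' C in XY1 *; set Y := derivative_mx c' c D in XY1.
have DJ : adapted J' c' J c D by exact: adapted_adjoint_mx.
have YJ : adapted J' c' J c Y by exact: adapted_derivative_mx.
pose X := C *m P; have XJ : adapted J c J' c' X by exact: adapted_mul PJ CJ.
(* [Z] is [X] with the chain-rule factor removed in advance, so that d Z extends X d. *)
pose Z : 'M[R]_(q, p) := \matrix_(j, k) (X j k * (slope (c' j) / slope (c k))).
have ZJ : adapted J c J' c' Z.
  by apply: adapted_sub XJ => j k; rewrite mxE mulf_eq0 negb_or => /andP[].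
have ZX : derivative_mx c c' Z = X.
  apply/matrixP => j k; rewrite !mxE -mulrA.
  have -> : slope (c' j) / slope (c k) * (slope (c k) / slope (c' j)) = 1.
    by field; rewrite !slope_neq0.
  by rewrite mulr1.
have ZD : Z *m D = 1%:M.
  (* The entries of Z D and X Y differ by the factor [slope (c' i) / slope (c' j)], which is 1 on
     the diagonal. *)
  apply/matrixP => i j; have /matrixP/(_ i j) := XY1; rewrite !mxE => XY1ij.
  transitivity (\sum_k X i k * Y k j * (slope (c' i) / slope (c' j))).
    apply: eq_bigr => k _; rewrite ![Z _ _]mxE ![Y _ _]mxE; field.
    by rewrite !slope_neq0.
  rewrite -mulr_suml XY1ij; have [->|_] := eqVneq i j; last by rewrite mul0r.
  by rewrite mul1r divff ?slope_neq0.
rewrite (mx_op_chart PJ); last by move=> j k /cP jk x; rewrite jk.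
have PV z : chart_op J c J' c' C (chart_op J c J c P z) = chart_op J c J' c' X z.
  exact: chart_op_comp.
rewrite /op_graph; apply/seteqP; split => -[x y] /=.
  (* Since [x] is [Z] applied to V^* x, it inherits from V^* x a derivative, namely X g. *)
  move=> [_ [g [_ -> xg] ->] ->]; rewrite PV -ZX.
  by have := ddx_chart_op ZJ xg; rewrite (chart_opK DJ ZJ ZD).
move=> xy; exists (chart_op J c J c P (chart_op J' c' J c Y y)).
  exists (chart_op J' c' J c Y y) => //.
  by exists (chart_op J' c' J c D x) => //; exact: ddx_chart_op.
by rewrite PV (chart_op_comp YJ XJ) XY1 chart_op1.
Qed.

Section reduction.
Context (R : realType) (N : nat) (I : 'I_N -> interval R).
Hypothesis I0 : forall k, nondegenerate (I k).
Variables (P1 : 'M[R]_N) (B : 'M[R]_N) (s : 'I_N -> bool).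
Local Notation I_class := (fun k => open_itv (I k)).
Hypothesis blockP1 : blockwise I_class P1.
Hypothesis blockB : blockwise I_class B.
Local Notation cI := (fun k => Phi_chart (I k)).

Lemma class_chart j k : I_class j = I_class k -> cI j = cI k.
Proof. by move=> /= jk; rewrite -(Phi_chart_open_itv (I j)) jk Phi_chart_open_itv. Qed.

(* With A the diagonal matrix of the slopes of the charts, which commutes with
   P1, and C the matrix of V, the identity V P1 d V^* = d reads
   C (P1 A^-2) C^T = diag((-1)^s). *)
Definition scaled_mx : 'M[R]_N := \matrix_(j, k) (P1 j k / slope (cI k) ^+ 2).

(** Nonzero entries of [P1] link intervals with equal slopes, so dividing by the slope of the column
    or of the row is the same. *)
Lemma scaled_mx_sym : P1 = P1^T -> scaled_mx = scaled_mx^T.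
Proof.
move=> symP1; apply/matrixP => j k; rewrite !mxE.
have -> : P1 k j = P1 j k by rewrite [in LHS]symP1 mxE.
have [->|/blockP1/class_chart] := eqVneq (P1 j k) 0; first by rewrite !mul0r.
by move=> jk; congr (_ / slope _ ^+ 2); exact/esym.
Qed.

Lemma scaled_mx_unit : P1 \in unitmx -> scaled_mx \in unitmx.
Proof.
move=> uP1; have -> : scaled_mx = P1 *m diag_mx (\row_k (slope (cI k) ^- 2)).
  by apply/matrixP => j k; rewrite mul_mx_diag !mxE.
rewrite unitmx_mul uP1/= unitmxE det_diag unitfE; apply/prodf_neq0 => k _.
by rewrite mxE invr_eq0; apply: expf_neq0; exact: lt0r_neq0 (Phi_slope_gt0 _).
Qed.

Lemma blockwise_scaled_mx : blockwise I_class scaled_mx.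
Proof. by move=> j k; rewrite mxE mulf_eq0 negb_or => /andP[/blockP1]. Qed.

Lemma adapted_blockwise (D : 'M[R]_N) : blockwise I_class D -> adapted I cI I cI D.
Proof.
move=> bD j k /bD jk x; rewrite !Phi_chart_interior//.
by rewrite (std_shape_open_itv (I0 j) (I0 k) jk).
Qed.

Hypothesis signB : B *m scaled_mx *m B^T = \matrix_(j, k) ((j == k)%:R * (-1) ^+ s j).

(** The half-lines that extend to +oo once the coordinates with negative sign are reflected. *)
Definition pos_idx : {set 'I_N} :=
  [set k | if s k then lower_unbounded_itv (I k)
           else upper_unbounded_itv (I k)]%SET.
Definition neg_idx : {set 'I_N} :=
  [set k | if s k then upper_unbounded_itv (I k)
           else lower_unbounded_itv (I k)]%SET.

Local Notation n := #|bnd_idx I|.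
Local Notation mp := #|pos_idx|.
Local Notation mm := #|neg_idx|.
Local Notation tau := (@block_idx N (bnd_idx I) pos_idx neg_idx).
Local Notation psi := (@Psi_idx R N I).
Local Notation J := (std_itv R n mp mm).
Local Notation cJ := (fun j => sign_chart R (s (tau j))).

Lemma partition_Psi k :
  ((k \in bnd_idx I) + (k \in up_idx I) + (k \in low_idx I) = 1)%N.
Proof. by have := I0 k; rewrite !inE; case: (I k) => [[? ?|[|]] [? ?|[|]]]. Qed.

Lemma partition_tau k :
  ((k \in bnd_idx I) + (k \in pos_idx) + (k \in neg_idx) = 1)%N.
Proof.
by have := I0 k; rewrite !inE; case: (s k); case: (I k) => [[? ?|[|]] [? ?|[|]]].
Qed.

Lemma Psi_idx_bij : bijective psi.
Proof. exact: block_idx_bij partition_Psi. Qed.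

Lemma std_itvE j : J j = flip_itv (s (tau j)) (std_shape (I (tau j))).
Proof.
rewrite /std_itv /block_idx.
case: fintype.split => [i|i]; first case: fintype.split => {}i.
- have := enum_valP i; rewrite inE; have := I0 (enum_val i).
  by case: (s _); case: (I _) => [[? ?|[|]] [? ?|[|]]] //=; rewrite opprK.
- have := enum_valP i; rewrite inE; have := I0 (enum_val i).
  by case: (s _); case: (I _) => [[? ?|[|]] [? ?|[|]]] //=; rewrite opprK.
- have := enum_valP i; rewrite inE; have := I0 (enum_val i).
  by case: (s _); case: (I _) => [[? ?|[|]] [? ?|[|]]] //=; rewrite opprK.
Qed.

Definition normal_mx : 'M[R]_(n + mp + mm, N) := \matrix_(j, k) B (tau j) k.

Lemma adapted_normal_mx : adapted I cI J cJ normal_mx.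
Proof.
move=> j k; rewrite mxE => /blockB jk x.
rewrite std_itvE interior_flip_itv Phi_chart_interior//.
by rewrite (std_shape_open_itv (I0 _) (I0 k) jk).
Qed.

(** The adjoint and the derivative each divide by the slope of [cI], which gives the square in
    [scaled_mx]. The slopes of [cJ] are signs: the adjoint sees 1, the derivative sees (-1)^s, and
    this cancels the signature. *)
Lemma normal_mx_derivative :
  (normal_mx *m P1) *m derivative_mx cJ cI (adjoint_mx cI cJ normal_mx) = 1%:M.
Proof.
have tau_inj := block_idx_inj partition_tau.
apply/matrixP => i j; have /matrixP/(_ (tau i) (tau j)) := signB; rewrite !mxE => signBij.
transitivity (\sum_k (B *m scaled_mx) (tau i) k * B^T k (tau j) * (-1) ^+ s (tau j)); last first.
  rewrite -mulr_suml signBij (inj_eq tau_inj); have [->|_] := eqVneq i j; last by rewrite !mul0r.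
  by rewrite mul1r -expr2 sqrr_sign.
apply: eq_bigr => k _.
have -> : (normal_mx *m P1) i k = (B *m P1) (tau i) k.
  by rewrite !mxE; apply: eq_bigr => l _; rewrite mxE.
have -> : (B *m scaled_mx) (tau i) k = (B *m P1) (tau i) k / Phi_slope (I k) ^+ 2.
  by rewrite !mxE mulr_suml; apply: eq_bigr => l _; rewrite mxE mulrA.
move: ((B *m P1) (tau i) k) => z; rewrite !mxE.
rewrite /= normr_sign (gtr0_norm (Phi_slope_gt0 _)).
move: (B (tau j) k) ((-1) ^+ _) => b e.
by field; rewrite (lt0r_neq0 (Phi_slope_gt0 _)).
Qed.

Lemma card_normal_blocks : (n + mp + mm)%N = N.
Proof. exact: card_blocks partition_tau. Qed.

Definition normal_op := chart_op I cI J cJ normal_mx.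

Definition normal_op_adjoint := chart_op J cJ I cI (adjoint_mx cI cJ normal_mx).

Lemma invertible_normal_op : invertible_op normal_op.
Proof.
have DJ := adapted_derivative_mx (adapted_adjoint_mx adapted_normal_mx).
have WJ := adapted_mul DJ (adapted_blockwise blockP1).
have VW : normal_mx *m (P1 *m derivative_mx cJ cI (adjoint_mx cI cJ normal_mx)) = 1%:M.
  by rewrite mulmxA normal_mx_derivative.
(* The right inverse of [normal_mx] contained in [normal_mx_derivative]; by equality of dimensions
   it is also a left inverse. *)
exists (chart_op J cJ I cI (P1 *m derivative_mx cJ cI (adjoint_mx cI cJ normal_mx))).
split; [exact: linear_chart_op|exact: bounded_chart_op| |].
- by apply: chart_opK adapted_normal_mx WJ _; exact: mulmx1C_eq_dim card_normal_blocks VW.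
- exact: chart_opK WJ adapted_normal_mx VW.
Qed.

(** Divides out in advance the normalizing factor by which [Psi] multiplies each coordinate. *)
Definition first_mx : 'M[R]_N := \matrix_(k, l) (B k l / Phi_factor (I k)).

(** A permutation matrix: [psi] sorts the half-lines before the reflection, [tau] after it. *)
Definition reorder_mx :
    'M[R]_(n + mp + mm, #|bnd_idx I| + #|up_idx I| + #|low_idx I|) :=
  \matrix_(j, i) (tau j == psi i)%:R.

Lemma product_normal_op : matrix_Psi_reflection_product normal_op.
Proof.
pose K := Psi_itv I; pose cK := fun i => sign_chart R (s (psi i)).
pose K' := fun i => flip_itv (s (psi i)) (K i).
pose c0 := fun _ : 'I_(#|bnd_idx I| + #|up_idx I| + #|low_idx I|) => sign_chart R false.
have block1 : blockwise I_class first_mx.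
  by move=> j k; rewrite mxE mulf_eq0 negb_or => /andP[/blockB].
have M1J := adapted_blockwise block1.
have c1 j k : first_mx j k != 0 -> cI k =1 cI j.
  by move=> /block1/class_chart/esym cjk x; rewrite cjk.
have M2J : adapted K c0 K c0 1%:M by exact: adapted1.
have RJ : adapted K c0 K' cK 1%:M.
  move=> i k; rewrite mxE; have [->|_] := eqVneq i k; last by rewrite eqxx.
  by move=> _ x; rewrite /K' /K Psi_itvE// interior_flip_itv sign_chartE.
have M3J : adapted K' cK J cJ reorder_mx.
  move=> j i; rewrite mxE; have [ji|_] := eqVneq (tau j) (psi i); last by rewrite eqxx.
  by move=> _ x; rewrite std_itvE /K' /K Psi_itvE// /cK ji.
have c3 j i : reorder_mx j i != 0 -> cK i =1 cJ j.
  rewrite mxE; have [ji _|_] := eqVneq (tau j) (psi i); last by rewrite eqxx.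
  by move=> x; rewrite /cK ji.
exists first_mx, 1%:M, (fun i => s (psi i)), reorder_mx; split.
- exact: compatible_chart M1J c1.
- exact: (compatible_chart M2J).
- exact: compatible_chart M3J c3.
- rewrite (mx_op_chart M1J c1) (mx_op_chart M2J)// (mx_op_chart M3J c3).
  rewrite (Psi_chart I0) (reflection_op_chart RJ) !op_graph_comp.
  congr op_graph; apply/funext => u /=.
  have PJ := adapted_Psi I0.
  rewrite (chart_op_comp M1J PJ) (chart_op_comp (adapted_mul M1J PJ) M2J).
  rewrite (chart_op_comp (adapted_mul (adapted_mul M1J PJ) M2J) RJ).
  rewrite (chart_op_comp (adapted_mul (adapted_mul (adapted_mul M1J PJ) M2J) RJ) M3J).
  rewrite /normal_op; congr (chart_op _ _ _ _ _ u); rewrite !mul1mx.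
  have [psi' psiK psi'K] := Psi_idx_bij.
  apply/matrixP => j k; rewrite !mxE (bigD1 (psi' (tau j)))//= mxE psi'K eqxx mul1r.
  rewrite big1 ?addr0 => [|i]; last first.
    by rewrite mxE; have [->|_] := eqVneq (tau j) (psi i); rewrite ?psiK ?eqxx// mul0r.
  rewrite mxE (bigD1 (tau j))//= !mxE psi'K eqxx mul1r.
  rewrite big1 ?addr0 => [|l lj]; last by rewrite mxE psi'K (negPf lj) !mul0r.
  by rewrite mulrC divfK// Phi_factor_neq0.
Qed.

End reduction.
Arguments normal_op {R N} I B s u.
Arguments normal_op_adjoint {R N} I B s u.

(** Compatibility gives one inclusion of interiors for each nonzero entry; the transposed entry
    gives the other. *)
Lemma compatible_blockwise (R : realType) (N : nat) (I : 'I_N -> interval R)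
    (P : 'M[R]_N) : (forall k, nondegenerate (I k)) -> P = P^T ->
  compatible I I P -> blockwise (fun k => open_itv (I k)) P.
Proof.
move=> I0 symP PI j k Pjk; apply: open_itv_inj => //.
have Pkj : P k j != 0 by rewrite symP mxE.
by apply/seteqP; split; exact: compatible_subset PI _ _ _.
Qed.

Theorem theorem3p2 (R : realType) (N : nat) (N_gt0 : (0 < N)%N)
    (I : 'I_N -> interval R)
    (I_interior : forall k, [set` I k]° !=set0)
    (I_complement : forall k, ~` [set` I k] !=set0)
    (P1 : 'M[R]_N)
    (P1_symmetric : P1 = P1^T)
    (P1_invertible : P1 \in unitmx)
    (P1_compatible : compatible I I P1) :
  exists n mp mm : nat, (n + mp + mm)%N = N /\
  exists (V : L2sum I -> L2sum (std_itv R n mp mm))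
         (Vs : L2sum (std_itv R n mp mm) -> L2sum I),
    [/\ linear_op V /\ bounded_op V,
        invertible_op V,
        adjoint V Vs,
        (op_graph V \; (mx_op I I P1 \; (ddx I \; op_graph Vs)))%relation
          = ddx (std_itv R n mp mm) &
        matrix_Psi_reflection_product V].
Proof.
have I0 k : nondegenerate (I k) by exact: nondegenerateP.
have blockP1 := compatible_blockwise I0 P1_symmetric P1_compatible.
have [B [s [blockB signB]]] := blockwise_signature
  (scaled_mx_sym blockP1 P1_symmetric) (scaled_mx_unit I P1_invertible)
  (blockwise_scaled_mx blockP1).
have VJ := adapted_normal_mx I0 (s := s) blockB.
exists #|bnd_idx I|, #|pos_idx I s|, #|neg_idx I s|; split; first exact: card_normal_blocks.
exists (normal_op I B s), (normal_op_adjoint I B s); split.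
- by split; [exact: linear_chart_op|exact: bounded_chart_op].
- exact: invertible_normal_op signB.
- exact: adjoint_chart_op.
- apply: conjugated_derivative => //.
  + exact: adapted_blockwise.
  + by move=> j k /blockP1/class_chart jk x; rewrite jk.
  + exact: normal_mx_derivative.
- exact: product_normal_op.
Qed.
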